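(* Let $K$ be an algebraically closed field of characteristic $0$ and let $S_1$ be the first symplectic Poisson algebra over $K$. Assume $f\in S_1$ is nilpotent or semisimple. Then there exists a unique pair $(k,n)\in(\mathbb{Z}_{\ge0})^2\setminus\{(0,0)\}$ with $k\ge n\ge0$ such that there exists $\phi\in\mathrm{Aut}(S_1)$ with $\phi(f)\in S_1(k,n)$. If $f$ is strictly semisimple, then $(k,n)=(1,1)$. If $f$ is nilpotent or weak semisimple, then $k>n$; if in addition $f\simeq f_1$, $f\simeq f_2$ and $f_1,f_2\in S_1(k,n)$, then $f_2=\phi(f_1)$ for some automorphism $\phi$ of the form $\phi(X)=a_1X+c_1$, $\phi(Y)=a_2Y+c_2$ with $a_1,a_2,c_1,c_2\in K$, $a_1a_2=1$.
   Context: $S_1$ is the polynomial algebra $K[X,Y]$ with the Poisson bracket $\{f,g\}=\frac{\partial f}{\partial X}\frac{\partial g}{\partial Y}-\frac{\partial f}{\partial Y}\frac{\partial g}{\partial X}$. $\mathrm{Aut}(S_1)$ is the group of $K$-algebra automorphisms of $K[X,Y]$ preserving the bracket. For $f,g\in S_1$ write $f\simeq g$ if $g=\phi(f)$ for some $\phi\in\mathrm{Aut}(S_1)$. For $k,n\in\mathbb{Z}_{\ge0}$, $S_1(k,n)$ is the set of $f=\sum a_{ij}X^iY^j\in S_1$ with $a_{kn}\ne0$ and $a_{ij}=0$ whenever $i>k$ or $j>n$. For $f\in S_1\setminus K$ let $\mathrm{ad}_f(g)=\{f,g\}$, $C(f)=\ker \mathrm{ad}_f$, $N(f)=\bigcup_{m>0}\ker(\mathrm{ad}_f)^m$,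 and $D(f)=\bigoplus_{\lambda}\ker(\mathrm{ad}_f-\lambda)$, the sum being over the eigenvalues $\lambda\in K$ of $\mathrm{ad}_f$. The element $f$ is strictly nilpotent if $N(f)=S_1$; weak nilpotent if $N(f)\ne C(f)$ and $N(f)\ne S_1$; strictly semisimple if $D(f)=S_1$; weak semisimple if $D(f)\ne C(f)$ and $D(f)\ne S_1$; generic if $D(f)=N(f)=C(f)$. These five classes are disjoint and exhaust $S_1\setminus K$. Nilpotent means strictly or weak nilpotent; semisimple means strictly or weak semisimple. *)

(* Defs.v *)
From HB Require Import structures.
From mathcomp Require Import all_boot all_order all_algebra.
From mathcomp Require Export mpoly.
Set Implicit Arguments.
Unset Strict Implicit.
Unset Printing Implicit Defensive.
Import GRing.Theory.
Local Open Scope ring_scope.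

Notation S1 K := {mpoly K[2]}.

Section SymplecticPoisson.
Variable K : closedFieldType.
Implicit Types (f g : S1 K).

Definition varX : S1 K := 'X_(0 : 'I_2).
Definition varY : S1 K := 'X_(1 : 'I_2).

Definition bracket f g : S1 K :=
  mderiv 0 f * mderiv 1 g - mderiv 1 f * mderiv 0 g.

Definition isAut (phi : {lrmorphism S1 K -> S1 K}) : Prop :=
  bijective phi /\ forall f g, phi (bracket f g) = bracket (phi f) (phi g).

Definition equivS1 f g : Prop :=
  exists phi : {lrmorphism S1 K -> S1 K}, isAut phi /\ g = phi f.

Definition rectS1 (k n : nat) f : Prop :=
  f@_[multinom [tuple k; n]] != 0 /\
  forall i j : nat, (k < i)%N \/ (n < j)%N -> f@_[multinom [tuple i; j]] = 0.

Definition nonconstant f : Prop := ~ exists c : K, f = c%:MP.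

Definition ad f : S1 K -> S1 K := bracket f.

(* Subspaces of S1 are predicates, compared extensionally with eqset. *)
Definition eqset (A B : S1 K -> Prop) : Prop := forall g, A g <-> B g.

Definition fullset : S1 K -> Prop := fun _ => True.

Definition centr f : S1 K -> Prop := fun g => ad f g = 0.

Definition nilspace f : S1 K -> Prop :=
  fun g => exists m : nat, (0 < m)%N /\ iter m (ad f) g = 0.

Definition ad_eigenvalue f (l : K) : Prop :=
  exists g, g != 0 /\ ad f g = l *: g.

(* Elements of the sum of the eigenspaces: finite sums of components e l taken
   over distinct eigenvalues l. The sum is automatically direct. *)
Definition eigsum f : S1 K -> Prop :=
  fun g => exists (s : seq K) (e : K -> S1 K),
    [/\ uniq s,
        forall l, l \in s -> ad_eigenvalue f l,
        forall l, l \in s -> ad f (e l) = l *: e l &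
        g = \sum_(l <- s) e l].

Definition strictly_nilpotent f : Prop :=
  nonconstant f /\ eqset (nilspace f) fullset.

Definition weak_nilpotent f : Prop :=
  [/\ nonconstant f, ~ eqset (nilspace f) (centr f)
    & ~ eqset (nilspace f) fullset].

Definition strictly_semisimple f : Prop :=
  nonconstant f /\ eqset (eigsum f) fullset.

Definition weak_semisimple f : Prop :=
  [/\ nonconstant f, ~ eqset (eigsum f) (centr f)
    & ~ eqset (eigsum f) fullset].

Definition nilpotent f : Prop := strictly_nilpotent f \/ weak_nilpotent f.

Definition semisimple f : Prop := strictly_semisimple f \/ weak_semisimple f.

Definition admissible_pair f (k n : nat) : Prop :=
  [/\ (k, n) <> (0%N, 0%N), (n <= k)%N &
      exists phi : {lrmorphism S1 K -> S1 K}, isAut phi /\ rectS1 k n (phi f)].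

End SymplecticPoisson.

Arguments varX {K}.
Arguments varY {K}.

(* Main.v *)
Require Import Defs.
From HB Require Import structures.
From mathcomp Require Import all_boot all_order all_algebra.
From mathcomp Require Import mpoly.
From mathcomp Require Import ring zify.
From Stdlib Require Import Classical.
Set Implicit Arguments.
Unset Strict Implicit.
Unset Printing Implicit Defensive.
Import GRing.Theory.
Local Open Scope ring_scope.

(** Give X and Y positive weights (a, b) and let L(f) be the component of f of top weight w(f).
    Then L({f,g}) = {L(f), L(g)} unless the latter vanishes, and homogeneous F, G with {F, G} = 0
    satisfy G^d = c F^e.  Replacing g by g^d - c f^e as long as L(g) commutes with L(f), one finds
    that for f nilpotent or semisimple either w(f) = a + b, or some homogeneous R satisfies
    {F, R} <> 0 = {F, {F, R}} with F = L(f).  Setting X = 1, the second alternative is a statement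
    on Wronskian-like expressions in one variable, and counting root multiplicities shows that
    F(1, Y) has very few roots.
    For total degree, L(f) becomes a monomial X^k Y^n after a linear change of variables; for an
    edge of the Newton polygon that leaves the rectangle, F(1, Y) has one root, so a triangular
    automorphism removes the edge and lowers the total degree.  Hence minimal total degree in the
    orbit gives an element of S_1(k, n).
    Conversely, if phi maps S_1(k, n) to S_1(k', n'), the top form of phi(f) is a monomial and equals
    c L(phi X)^k L(phi Y)^n.  As ad_(phi X) is locally nilpotent, L(phi X) is a pure power of X or
    of Y when it is a monomial, and so is L(phi Y); if n, n' > 0, then {phi X, phi Y} = 1 makes phi
    affine, with linear part diagonal or antidiagonal. *)

(** * Monomials, partial derivatives and the Poisson bracket *)

Section Monomials.
Variable K : closedFieldType.
Implicit Types (f g : S1 K) (m : 'X_{1..2}).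

Definition mon (i j : nat) : 'X_{1..2} := [multinom [tuple i; j]].

Lemma mon0 i j : mon i j (0 : 'I_2)%R = i.
Proof. by rewrite multinomE. Qed.

Lemma mon1 i j : mon i j (1 : 'I_2)%R = j.
Proof. by rewrite multinomE. Qed.

Lemma ord2P (i : 'I_2) : i = 0 \/ i = 1.
Proof. by case: i => [[|[|[]]] Hi] //; [left | right]; apply/val_inj. Qed.

Lemma monE m : m = mon (m 0%R) (m 1%R).
Proof. by apply/mnmP=> i; case: (ord2P i) => ->; rewrite ?mon0 ?mon1. Qed.

Lemma monD i j i' j' : (mon i j + mon i' j')%MM = mon (i + i') (j + j').
Proof. by apply/mnmP=> l; rewrite mnmDE; case: (ord2P l) => ->; rewrite ?mon0 ?mon1. Qed.

Lemma U0E : U_(0%R : 'I_2)%MM = mon 1 0.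
Proof. by apply/mnmP=> l; rewrite mnm1E; case: (ord2P l) => ->; rewrite ?mon0 ?mon1. Qed.

Lemma U1E : U_(1%R : 'I_2)%MM = mon 0 1.
Proof. by apply/mnmP=> l; rewrite mnm1E; case: (ord2P l) => ->; rewrite ?mon0 ?mon1. Qed.

Lemma monX i j : 'X_[mon i j] = varX ^+ i * varY ^+ j :> S1 K.
Proof.
rewrite /varX /varY U0E U1E !mpolyXn -mpolyXD; congr mpolyX; apply/mnmP=> l.
by rewrite mnmDE !mulmnE; case: (ord2P l) => ->; rewrite ?mon0 ?mon1; lia.
Qed.

(** Reduces identities between ring morphisms and derivations to constants, X and Y. *)
Lemma S1_ind (P : S1 K -> Prop) :
  (forall c, P c%:MP) -> P varX -> P varY ->
  (forall f g, P f -> P g -> P (f + g)) ->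
  (forall f g, P f -> P g -> P (f * g)) -> forall f, P f.
Proof.
move=> hC hX hY hD hM; have hXn h n : P h -> P (h ^+ n).
  by move=> ?; elim: n => [|n IH]; rewrite ?expr0 -?mpolyC1 ?exprS; auto.
elim/mpolyind=> [|c m f _ _ hf]; first by rewrite -mpolyC0; auto.
by apply: (hD) => //; rewrite -mul_mpolyC (monE m) monX; auto.
Qed.

Lemma subUU (i : 'I_2) : (U_(i) - U_(i))%MM = 0%MM.
Proof. by apply/mnmP=> l; rewrite mnmBE mnm0E subnn. Qed.

Lemma mderivX0 : mderiv 0 varX = 1 :> S1 K.
Proof. by rewrite mderivX mnm1E eqxx scale1r subUU mpolyX0. Qed.
Lemma mderivX1 : mderiv 1 varX = 0 :> S1 K.
Proof. by rewrite mderivX mnm1E scale0r. Qed.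
Lemma mderivY0 : mderiv 0 varY = 0 :> S1 K.
Proof. by rewrite mderivX mnm1E scale0r. Qed.
Lemma mderivY1 : mderiv 1 varY = 1 :> S1 K.
Proof. by rewrite mderivX mnm1E eqxx scale1r subUU mpolyX0. Qed.

Lemma mderivXn i f n : mderiv i (f ^+ n) = (f ^+ n.-1 * mderiv i f) *+ n :> S1 K.
Proof.
elim: n => [|n IH]; first by rewrite mulr0n expr0 -mpolyC1 mderivC.
rewrite exprS mderivM IH /=; case: n IH => [|n] IH; first by rewrite mulr0n; ring.
by rewrite /= exprS; ring.
Qed.

(** The Euler operator is diagonal on monomials, which avoids the exponent shift of
    [mcoeff_deriv]. *)
Lemma coef_XdX f m : (varX * mderiv 0 f)@_m = f@_m *+ m 0%R.
Proof.
rewrite (monE m) mon0; case: (m 0%R) => [|i]; last first.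
  have -> : mon i.+1 (m 1%R) = (U_(0%R) + mon i (m 1%R))%MM by rewrite U0E monD.
  by rewrite mulrC /varX mcoeffMX mcoeff_deriv addmC mon0.
rewrite mulr0n mulrC; apply/eqP; rewrite mcoeff_eq0; apply/negP=> /msuppM_le /allpairsP [[m1 m2] /= [_]].
rewrite msuppX inE => /eqP -> /(congr1 (fun m : 'X_{1..2} => m 0%R)).
by rewrite mnmDE mon0 mnm1E eqxx addn1.
Qed.

Lemma coef_YdY f m : (varY * mderiv 1 f)@_m = f@_m *+ m 1%R.
Proof.
rewrite (monE m) mon1; case: (m 1%R) => [|j]; last first.
  have -> : mon (m 0%R) j.+1 = (U_(1%R) + mon (m 0%R) j)%MM by rewrite U1E monD.
  by rewrite mulrC /varY mcoeffMX mcoeff_deriv addmC mon1.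
rewrite mulr0n mulrC; apply/eqP; rewrite mcoeff_eq0; apply/negP=> /msuppM_le /allpairsP [[m1 m2] /= [_]].
rewrite msuppX inE => /eqP -> /(congr1 (fun m : 'X_{1..2} => m 1%R)).
by rewrite mnmDE mon1 mnm1E eqxx addn1.
Qed.

Lemma bracketC c f : bracket f c%:MP = 0.
Proof. by rewrite /bracket !mderivC; ring. Qed.
Lemma bracketDr f g h : bracket f (g + h) = bracket f g + bracket f h.
Proof. by rewrite /bracket !mderivD; ring. Qed.
Lemma bracketZr f c g : bracket f (c *: g) = c *: bracket f g.
Proof. by rewrite /bracket !mderivZ -!mul_mpolyC; ring. Qed.
Lemma bracketMr f g h : bracket f (g * h) = bracket f g * h + g * bracket f h.
Proof. by rewrite /bracket !mderivM; ring. Qed.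
Lemma bracket_antisym f g : bracket f g = - bracket g f.
Proof. by rewrite /bracket; ring. Qed.
Lemma bracketff f : bracket f f = 0.
Proof. by rewrite /bracket; ring. Qed.
Lemma bracket0r f : bracket f 0 = 0.
Proof. by rewrite -mpolyC0 bracketC. Qed.
Lemma bracketXnr f g n : bracket f (g ^+ n) = (g ^+ n.-1 * bracket f g) *+ n.
Proof. by rewrite /bracket !mderivXn; ring. Qed.
Lemma bracketXY : bracket varX varY = 1 :> S1 K.
Proof. by rewrite /bracket mderivX0 mderivX1 mderivY0 mderivY1; ring. Qed.
Lemma bracketXr f : bracket f varX = - mderiv 1 f.
Proof. by rewrite /bracket mderivX0 mderivX1; ring. Qed.
Lemma bracketYr f : bracket f varY = mderiv 0 f.
Proof. by rewrite /bracket mderivY0 mderivY1; ring. Qed.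

Hypothesis char0 : [pchar K] =i pred0.

Lemma natK_eq0 n : ((n%:R : K) == 0) = (n == 0)%N.
Proof. by have /pcharf0P-> := char0. Qed.

Lemma natK_inj (m n : nat) : (m%:R : K) = n%:R -> m = n.
Proof.
wlog le_mn : m n / (m <= n)%N.
  by move=> h; case/orP: (leq_total m n) => /h // h' /esym /h'.
move=> e; have : ((n - m)%:R : K) == 0 by rewrite natrB // e subrr.
by rewrite natK_eq0; lia.
Qed.

(** Both Euler operators kill f, so in characteristic 0 a nonzero coefficient at m forces both
    exponents of m to vanish. *)
Lemma mderiv_eq0 f : mderiv 0 f = 0 -> mderiv 1 f = 0 -> f = (f@_0%MM)%:MP.
Proof.
move=> h0 h1; apply/mpolyP=> m; rewrite mcoeffC; case: eqVneq => [->|mN0]; rewrite ?mulr1 // mulr0.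
have e0 := coef_XdX f m; have e1 := coef_YdY f m.
rewrite h0 mulr0 mcoeff0 in e0; rewrite h1 mulr0 mcoeff0 in e1.
move/esym/eqP: e0; move/esym/eqP: e1; rewrite -mulr_natr mulf_eq0 natK_eq0 -mulr_natr mulf_eq0 natK_eq0.
case: (f@_m =P 0) => //= _ /eqP e1 /eqP e0; case/eqP: mN0.
by rewrite (monE m) e0 e1; apply/mnmP=> l; rewrite mnm0E; case: (ord2P l) => ->; rewrite ?mon0 ?mon1.
Qed.

Lemma centr_const f : (forall g, bracket f g = 0) -> f = (f@_0%MM)%:MP.
Proof.
move=> h; apply: mderiv_eq0; first by rewrite -bracketYr h.
by apply/eqP; rewrite -oppr_eq0 -bracketXr h.
Qed.

End Monomials.

(** * Weighted degrees and leading forms *)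

(** Size bounds replace exact degrees, because the top coefficients may vanish after
    differentiation. *)
Lemma coef_top_mul (R : comNzRingType) (p q : {poly R}) d e :
  (size p <= d.+1)%N -> (size q <= e.+1)%N -> (p * q)`_(d + e) = p`_d * q`_e.
Proof.
move=> sp sq; rewrite coefM (bigD1 (inord d : 'I_(d + e).+1)) //= inordK ?ltnS ?leq_addr //.
rewrite addKn big1 ?addr0 // => i; rewrite -val_eqE /= inordK ?ltnS ?leq_addr // => ne.
case: (ltnP i d) => h; last by rewrite nth_default ?mul0r // (leq_trans sp) // ltn_neqAle eq_sym ne.
by rewrite mulrC nth_default ?mul0r // (leq_trans sq) // ltn_subRL ltn_add2r.
Qed.

Lemma size_mul_leq (R : comNzRingType) (p q : {poly R}) d e :
  (size p <= d.+1)%N -> (size q <= e.+1)%N -> (size (p * q)%R <= (d + e).+1)%N.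
Proof.
move=> sp sq; apply: leq_trans (size_polyMleq _ _) _.
by move: sp sq; move: (size p) (size q) => x y; lia.
Qed.

Section Weights.
Variable K : closedFieldType.
Variables a b : nat.
Implicit Types (f g F G : S1 K) (m : 'X_{1..2}).

Definition wt m : nat := (a * m 0%R + b * m 1%R)%N.

(* The coefficient of t^d is the component of weight d: Phi f = f(X t^a, Y t^b). *)
Definition weight_grading (f : S1 K) : {poly S1 K} :=
  mmap (@polyC (S1 K) \o @mpolyC 2 K)
       (fun i => ('X_i)%:P * 'X^(if i == 0 then a else b)) f.

HB.instance Definition _ := GRing.RMorphism.copy weight_grading weight_grading.

(* Locked, since unification would otherwise unfold the sum defining mmap. *)
Definition Phi := locked weight_grading.

Lemma Phi_rmorph : nmod_morphism Phi * monoid_morphism Phi.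
Proof.
rewrite /Phi -lock; split; first by split=> [|x y]; rewrite ?rmorph0 ?rmorphD.
by split=> [|x y]; rewrite ?rmorph1 ?rmorphM.
Qed.

HB.instance Definition _ := GRing.isNmodMorphism.Build _ _ Phi Phi_rmorph.1.
HB.instance Definition _ := GRing.isMonoidMorphism.Build _ _ Phi Phi_rmorph.2.


Lemma PhiC c : Phi c%:MP = (c%:MP)%:P.
Proof. by rewrite /Phi -lock /weight_grading mmapC. Qed.

Lemma PhiVX : Phi varX = varX%:P * 'X^a.
Proof. by rewrite /Phi -lock /weight_grading mmapX mmap1U. Qed.

Lemma PhiVY : Phi varY = varY%:P * 'X^b.
Proof. by rewrite /Phi -lock /weight_grading mmapX mmap1U. Qed.


Lemma PhiMon c m : Phi (c *: 'X_[m]) = (c *: 'X_[m])%:P * 'X^(wt m).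
Proof.
rewrite (monE m); move: (m 0%R) (m 1%R) => i j; rewrite /wt mon0 mon1 -mul_mpolyC monX.
by rewrite !rmorphM !rmorphXn /= PhiC PhiVX PhiVY exprD !exprM !exprMn; ring.
Qed.

Lemma coef_Phi f d m : ((Phi f)`_d)@_m = if wt m == d then f@_m else 0.
Proof.
elim/mpolyind: f => [|c m' f _ _ IH]; first by rewrite rmorph0 coef0 mcoeff0 if_same.
rewrite rmorphD coefD /= PhiMon coefMXn coefC mcoeffD IH {IH} mcoeffD mcoeffZ mcoeffX.
case: ltnP => h.
  rewrite mcoeff0 add0r; case: eqP => // e; case: eqP => [em|]; last by rewrite mulr0 add0r.
  by move: h; rewrite em e ltnn.
rewrite subn_eq0; case: (leqP d (wt m')) => h'.
  have ed : d = wt m' by apply/eqP; rewrite eqn_leq h h'.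
  rewrite mcoeffZ mcoeffX; case: eqP => [<-|em]; first by rewrite ed eqxx.
  by rewrite !mulr0 !add0r.
rewrite mcoeff0 add0r; case: eqP => // e; case: eqP => [em|]; last by rewrite mulr0 add0r.
by move: h'; rewrite em e ltnn.
Qed.

Lemma Phi_eq0 f : (Phi f == 0) = (f == 0).
Proof.
apply/eqP/eqP=> [h|->]; last by rewrite rmorph0.
apply/mpolyP=> m; have := coef_Phi f (wt m) m.
by rewrite h coef0 eqxx mcoeff0.
Qed.

Definition pderiv (i : 'I_2) (p : {poly S1 K}) : {poly S1 K} :=
  map_poly (mderiv i : S1 K -> S1 K) p.

Lemma coef_pderiv i p j : (pderiv i p)`_j = mderiv i p`_j.
Proof. by rewrite coef_map_id0 // mderiv0. Qed.

Lemma map_mderiv0_Phi f : pderiv 0 (Phi f) = Phi (mderiv 0 f) * 'X^a.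
Proof.
apply/polyP=> d; apply/mpolyP=> m; rewrite coef_pderiv mcoeff_deriv coefMXn coef_Phi.
have -> : wt (m + U_(0%R : 'I_2)) = (wt m + a)%N.
  by rewrite /wt !mnmDE !mnm1E eqxx /=; lia.
case: ltnP => h; first by rewrite mcoeff0; case: eqP => [e|_]; [lia | rewrite mul0rn].
rewrite coef_Phi mcoeff_deriv.
have -> : (wt m + a == d)%N = (wt m == d - a)%N by lia.
by case: ifP => // _; rewrite mul0rn.
Qed.

Lemma map_mderiv1_Phi f : pderiv 1 (Phi f) = Phi (mderiv 1 f) * 'X^b.
Proof.
apply/polyP=> d; apply/mpolyP=> m; rewrite coef_pderiv mcoeff_deriv coefMXn coef_Phi.
have -> : wt (m + U_(1%R : 'I_2)) = (wt m + b)%N.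
  by rewrite /wt !mnmDE !mnm1E eqxx /=; lia.
case: ltnP => h; first by rewrite mcoeff0; case: eqP => [e|_]; [lia | rewrite mul0rn].
rewrite coef_Phi mcoeff_deriv.
have -> : (wt m + b == d)%N = (wt m == d - b)%N by lia.
by case: ifP => // _; rewrite mul0rn.
Qed.

(** Read off from [Phi f] as a polynomial in t over a domain, the weighted degree and the leading
    form inherit multiplicativity. Zero gets degree 0. *)
Definition wdeg f : nat := (size (Phi f)).-1.
Definition wlead f : S1 K := lead_coef (Phi f).

Lemma coef_wlead f m : (wlead f)@_m = if wt m == wdeg f then f@_m else 0.
Proof. exact: coef_Phi. Qed.

Lemma wlead_eq0 f : (wlead f == 0) = (f == 0).
Proof. by rewrite lead_coef_eq0 Phi_eq0. Qed.

Lemma wdeg_ge f m : f@_m != 0 -> (wt m <= wdeg f)%N.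
Proof.
move=> fm; rewrite /wdeg; have : (Phi f)`_(wt m) != 0.
  by apply: contraNneq fm => h; have := coef_Phi f (wt m) m; rewrite h eqxx mcoeff0 => <-.
by case: (ltnP (wt m) (size (Phi f))) => h; [lia | rewrite nth_default // eqxx].
Qed.

Lemma wdeg_ex f : f != 0 -> exists2 m, f@_m != 0 & wt m = wdeg f.
Proof.
rewrite -(wlead_eq0 f) => h; exists (mlead (wlead f)); move: h; rewrite -mleadc_eq0 coef_wlead.
  by case: ifP; rewrite ?eqxx.
by case: ifP => [/eqP|]; rewrite ?eqxx.
Qed.

Lemma wdeg_le f d : (forall m, f@_m != 0 -> (wt m <= d)%N) -> (wdeg f <= d)%N.
Proof.
move=> h; case: (eqVneq f 0) => [->|/wdeg_ex [m /h ? <- //]].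
by rewrite /wdeg rmorph0 size_poly0.
Qed.

Lemma size_Phi_gt0 f : f != 0 -> (0 < size (Phi f))%N.
Proof. by rewrite size_poly_gt0 Phi_eq0. Qed.

Lemma size_mul_pred (p q : {poly S1 K}) : p != 0 -> q != 0 ->
  (size (p * q)).-1 = ((size p).-1 + (size q).-1)%N.
Proof.
move=> p0 q0; rewrite size_mul //; move: p0 q0; rewrite -!size_poly_gt0.
by case: (size p) (size q) => [|x] [|y] //; rewrite addnS.
Qed.

Lemma wdegM f g : f != 0 -> g != 0 -> wdeg (f * g) = (wdeg f + wdeg g)%N.
Proof. by move=> f0 g0; rewrite /wdeg rmorphM size_mul_pred ?Phi_eq0. Qed.

Lemma wleadM f g : wlead (f * g) = wlead f * wlead g.
Proof. by rewrite /wlead rmorphM lead_coefM. Qed.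

Lemma wleadX f n : wlead (f ^+ n) = wlead f ^+ n.
Proof. by rewrite /wlead rmorphXn lead_coef_exp. Qed.

Lemma wdegX f n : f != 0 -> wdeg (f ^+ n) = (n * wdeg f)%N.
Proof.
move=> f0; elim: n => [|n IH]; last by rewrite exprS wdegM ?expf_neq0 // IH mulSn.
by rewrite expr0 /wdeg rmorph1 size_poly1.
Qed.

(** Zero is homogeneous of every weight, so homogeneous elements of a given weight form a
    subspace. *)
Definition whom d F : Prop := forall m, F@_m != 0 -> wt m = d.

Lemma whomP d F : whom d F <-> Phi F = F%:P * 'X^d.
Proof.
split=> [h|h m]; last first.
  move=> Fm; move: (coef_Phi F (wt m) m); rewrite h coefMXn coefC eqxx.
  case: ltnP => [_ e|le_d]; first by move: Fm; rewrite -e mcoeff0 eqxx.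
  by case: eqP => [|_ e]; [lia | move: Fm; rewrite -e mcoeff0 eqxx].
apply/polyP=> i; apply/mpolyP=> m; rewrite coef_Phi coefMXn coefC.
case: (eqVneq F@_m 0) => [e|/h ->].
  by rewrite e if_same; case: ltnP; rewrite ?mcoeff0 // => _; case: ifP; rewrite ?e ?mcoeff0.
case: (ltngtP d i) => [lt|_|<-]; rewrite ?mcoeff0 ?subnn //.
by rewrite subn_eq0 leqNgt lt mcoeff0.
Qed.

Lemma whom_wlead f : whom (wdeg f) (wlead f).
Proof. by move=> m; rewrite coef_wlead; case: (wt m =P _) => // _; rewrite eqxx. Qed.

Lemma whom_deg d F : whom d F -> F != 0 -> wdeg F = d.
Proof. by move=> h /wdeg_ex [m /h -> ->]. Qed.

Lemma whom_lead d F : whom d F -> wlead F = F.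
Proof.
move=> h; case: (eqVneq F 0) => [->|F0]; first by apply/eqP; rewrite wlead_eq0.
apply/mpolyP=> m; rewrite coef_wlead (whom_deg h F0); case: (wt m =P d) => // e.
by apply/esym/eqP; apply: contraT => /h /e.
Qed.

Lemma whomD d F G : whom d F -> whom d G -> whom d (F + G).
Proof. by move=> /whomP h1 /whomP h2; apply/whomP; rewrite rmorphD /= h1 h2 polyCD mulrDl. Qed.

Lemma whomM d e F G : whom d F -> whom e G -> whom (d + e) (F * G).
Proof. by move=> /whomP h1 /whomP h2; apply/whomP; rewrite rmorphM /= h1 h2 polyCM exprD /=; ring. Qed.

Lemma whomC c : whom 0 c%:MP.
Proof. by apply/whomP; rewrite PhiC expr0 mulr1. Qed.

Lemma whomZ d c F : whom d F -> whom d (c *: F).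
Proof. by rewrite -mul_mpolyC => h; apply: (@whomM 0) => //; exact: whomC. Qed.

Lemma whomX d F n : whom d F -> whom (n * d) (F ^+ n).
Proof. by move=> /whomP h; apply/whomP; rewrite rmorphXn /= h exprMn polyC_exp -exprM mulnC. Qed.

Lemma whom_varX : whom a varX.
Proof. by apply/whomP; rewrite PhiVX. Qed.

Lemma whom_varY : whom b varY.
Proof. by apply/whomP; rewrite PhiVY. Qed.

(** The derivatives in X and Y lower the weight by a and b, so the bracket lowers it by a + b; the
    factor t^(a+b) compensates and keeps all exponents nonnegative. *)
Lemma Phi_bracket f g : Phi (bracket f g) * 'X^(a + b) =
  pderiv 0 (Phi f) * pderiv 1 (Phi g) -
  pderiv 1 (Phi f) * pderiv 0 (Phi g).
Proof.
rewrite !map_mderiv0_Phi !map_mderiv1_Phi /bracket rmorphB !rmorphM exprD /=; ring.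
Qed.

(** The weight s is given by an equation instead of a truncated difference: a nonzero bracket forces
    a + b <= d + e. *)
Lemma whom_bracket d e F G : whom d F -> whom e G -> bracket F G != 0 ->
  exists2 s, (s + (a + b) = d + e)%N & whom s (bracket F G).
Proof.
move=> /whomP hF /whomP hG n0; have := Phi_bracket F G.
have der (i : 'I_2) (H : S1 K) k : pderiv i (H%:P * 'X^k) = (mderiv i H)%:P * 'X^k.
  have cE (L : S1 K) j : (L%:P * 'X^k)`_j = if j == k then L else 0.
    by rewrite coefCM coefXn; case: (j == k); rewrite ?mulr1 ?mulr0.
  apply/polyP=> j.
  rewrite coef_pderiv; transitivity (mderiv i (if j == k then H else 0)).
    by congr (mderiv i _); exact: cE.
  by apply: etrans (esym (cE _ j)); case: (j == k) => //; rewrite mderiv0.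
rewrite hF hG !der => eP.
have {}eP : Phi (bracket F G) * 'X^(a + b) = (bracket F G)%:P * 'X^(d + e).
  rewrite eP exprD /bracket polyCB !polyCM; ring.
have le : (a + b <= d + e)%N.
  rewrite leqNgt; apply/negP=> lt; move/(congr1 (fun p : {poly S1 K} => p`_(d + e))): eP.
  by rewrite !coefMXn lt ltnn subnn coefC /= => /esym/eqP; rewrite (negPf n0).
exists (d + e - (a + b))%N; first by lia.
apply/whomP; apply: (@mulIf _ 'X^(a + b)); first by rewrite expf_neq0 // polyX_eq0.
by rewrite eP -mulrA -exprD; congr (_ * 'X^_); lia.
Qed.

(** In degree w(f) + w(g) only the two leading forms contribute. Both [wlead_bracket] and
    [wlead_centr] are read off from this coefficient. *)
Lemma coef_Phi_bracket f g :
  (Phi (bracket f g) * 'X^(a + b))`_(wdeg f + wdeg g) = bracket (wlead f) (wlead g).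
Proof.
have sz h i : (size (pderiv i (Phi h)) <= (wdeg h).+1)%N.
  by rewrite (leq_trans (size_poly _ _)) // leqSpred.
by rewrite Phi_bracket coefB !coef_top_mul ?sz // !coef_pderiv.
Qed.

Lemma wdeg_bracket_le f g : bracket f g != 0 ->
  (wdeg (bracket f g) + (a + b) <= wdeg f + wdeg g)%N.
Proof.
move=> n0; have sz h i : (size (pderiv i (Phi h)) <= (wdeg h).+1)%N.
  by rewrite (leq_trans (size_poly _ _)) // leqSpred.
have h0 : Phi (bracket f g) != 0 by rewrite Phi_eq0.
have X0 : 'X^(a + b) != 0 :> {poly S1 K} by rewrite expf_neq0 // polyX_eq0.
have := size_mul_pred h0 X0; rewrite size_polyXn /= -/(wdeg _) => <-.
rewrite -subn1 leq_subLR add1n Phi_bracket (leq_trans (size_polyD _ _)) //.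
by rewrite size_polyN geq_max; apply/andP; split; rewrite size_mul_leq ?sz.
Qed.

Lemma wlead_bracket f g : bracket (wlead f) (wlead g) != 0 ->
  wlead (bracket f g) = bracket (wlead f) (wlead g) /\
  (wdeg (bracket f g) + (a + b) = wdeg f + wdeg g)%N.
Proof.
move=> n0; have e := coef_Phi_bracket f g.
have h0 : bracket f g != 0.
  by apply: contraNneq n0 => h; rewrite -e h rmorph0 mul0r coef0.
have le := wdeg_bracket_le h0.
move: e; rewrite coefMXn; case: ltnP => [lt e|h]; first by move: n0; rewrite -e eqxx.
move=> e; have ed : (wdeg f + wdeg g - (a + b) = wdeg (bracket f g))%N.
  have : (wdeg f + wdeg g - (a + b) < size (Phi (bracket f g)))%N.
    rewrite ltnNge; apply/negP=> /(nth_default 0) h'; move: n0; by rewrite -e h' eqxx.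
  by move: le; rewrite /wdeg; lia.
by split; [rewrite -e ed | lia].
Qed.

Lemma wlead_centr f g : bracket f g = 0 -> bracket (wlead f) (wlead g) = 0.
Proof. by move=> h; rewrite -coef_Phi_bracket h rmorph0 mul0r coef0. Qed.

End Weights.

(** * Weighted Wronskians of polynomials in one variable *)

Section Univariate.
Variable K : closedFieldType.
Hypothesis char0 : [pchar K] =i pred0.
Implicit Types (p q : {poly K}) (z : K).

(** The trace at X = 1 of the bracket of forms of weights D and e, see [dehom_bracket]. It is p q
    times the logarithmic derivative of q^D / p^e. *)
Definition wronsk (D e : nat) p q : {poly K} := (p * q^`()) *+ D - (p^`() * q) *+ e.

Lemma coef_Xderiv p n : ('X * p^`())`_n = p`_n *+ n.
Proof. by case: n => [|n]; rewrite coefXM ?mulr0n //= coef_deriv. Qed.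

Lemma size_Xderiv p n : (size p <= n.+1)%N -> (size ('X * p^`())%R <= n.+1)%N.
Proof.
move=> sp; apply/leq_sizeP => j hj; rewrite coef_Xderiv nth_default ?mul0rn //.
exact: leq_trans sp hj.
Qed.

(** The factor X turns derivatives into Euler operators, so that degree 0 needs no separate
    treatment. *)
Lemma coef_Xwronsk D e p q n l : (size p <= n.+1)%N -> (size q <= l.+1)%N ->
  ('X * wronsk D e p q)`_(n + l) = p`_n * q`_l * ((D * l)%:R - (e * n)%:R).
Proof.
move=> sp sq; have -> : 'X * wronsk D e p q =
    (p * ('X * q^`())) *+ D - (('X * p^`()) * q) *+ e by rewrite /wronsk; ring.
rewrite coefB !coefMn !coef_top_mul ?size_Xderiv // !coef_Xderiv !natrM; ring.
Qed.

Lemma size_Xwronsk D e p q n l : (size p <= n.+1)%N -> (size q <= l.+1)%N ->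
  (size ('X * wronsk D e p q)%R <= (n + l).+1)%N.
Proof.
move=> sp sq; have -> : 'X * wronsk D e p q =
    (p * ('X * q^`())) *+ D - (('X * p^`()) * q) *+ e by rewrite /wronsk; ring.
have sM (u v : {poly K}) i : (size u <= n.+1)%N -> (size v <= l.+1)%N ->
    (size (u * v *+ i)%R <= (n + l).+1)%N.
  move=> su sv; rewrite -scaler_nat (leq_trans (size_scale_leq _ _)) //.
  exact: size_mul_leq.
by rewrite (leq_trans (size_polyD _ _)) // size_polyN geq_max !sM // size_Xderiv.
Qed.

Lemma wronsk_deg0 D e p q : p != 0 -> q != 0 -> wronsk D e p q = 0 ->
  (D * (size q).-1 = e * (size p).-1)%N.
Proof.
move=> p0 q0 w0; have := @coef_Xwronsk D e p q (size p).-1 (size q).-1.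
rewrite w0 mulr0 coef0 !leqSpred => /(_ isT isT) /esym/eqP.
rewrite !mulf_eq0 -!lead_coefE !lead_coef_eq0 (negPf p0) (negPf q0) /= subr_eq0.
by move/eqP/(natK_inj char0).
Qed.

(** The coefficient in degree deg p + deg q - 1 is a nonzero multiple of D deg q - e deg p, so the
    degree drops further only when this number vanishes. *)
Lemma wronsk_deg D e p q : p != 0 -> q != 0 -> wronsk D e p q != 0 ->
  (D * (size q).-1 = e * (size p).-1)%N \/
  (size (wronsk D e p q) = (size p).-1 + (size q).-1)%N.
Proof.
move=> p0 q0 w0; have := @coef_Xwronsk D e p q (size p).-1 (size q).-1.
have := @size_Xwronsk D e p q (size p).-1 (size q).-1.
rewrite !leqSpred => /(_ isT isT) sz /(_ isT isT).
rewrite -!lead_coefE => ec; case: (eqVneq (D * (size q).-1)%N (e * (size p).-1)%N) => [e1|ne]; [by left|right].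
have : ('X * wronsk D e p q)`_((size p).-1 + (size q).-1) != 0.
  rewrite ec !mulf_neq0 ?lead_coef_eq0 // subr_eq0.
  by apply: contra_neq ne; apply: natK_inj.
move=> c0; have : ((size p).-1 + (size q).-1 < size ('X * wronsk D e p q)%R)%N.
  by rewrite ltnNge; apply: contra_neqN c0 => /leq_sizeP ->.
move: sz; rewrite mulrC size_mulX // !ltnS => h1 h2.
by apply/eqP; rewrite eqn_leq h1 h2.
Qed.

(** Subtract from q the multiple of p with the same leading coefficient. A nonzero difference h
    would still have zero Wronskian with p, hence the degree of p, where its coefficient was just
    cancelled. *)
Lemma wronsk_const p q : p != 0 -> wronsk 1 1 p q = 0 -> exists c, q = c *: p.
Proof.
move=> p0 w0; exists (lead_coef q / lead_coef p); apply/eqP; rewrite -subr_eq0.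
case: (eqVneq q 0) => [->|q0]; first by rewrite lead_coef0 mul0r scale0r subrr.
set h := q - _; apply: contraT => h0.
have wh : wronsk 1 1 p h = 0.
  have -> : wronsk 1 1 p h = wronsk 1 1 p q.
    by rewrite /wronsk /h derivB derivZ -!mul_polyC; ring.
  by [].
have := wronsk_deg0 p0 h0 wh; have := wronsk_deg0 p0 q0 w0; rewrite !mul1n => e1 e2.
have : lead_coef h != 0 by rewrite lead_coef_eq0.
rewrite lead_coefE e2 /h coefB coefZ -lead_coefE mulfVK ?lead_coef_eq0 //.
by rewrite -e1 -lead_coefE subrr eqxx.
Qed.

(** The local expansion at z: if u and v do not vanish there, the first factor on the right takes
    the value u v (D t - e s) at z. *)
Lemma wronsk_XsubC D e (u v : {poly K}) z s t :
  let x := 'X - z%:P in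
  x * wronsk D e (u * x ^+ s) (v * x ^+ t) =
  ((u * v) *+ (D * t) - (u * v) *+ (e * s) + x * wronsk D e u v) * x ^+ (s + t).
Proof.
move=> x; have dX n : x * (x ^+ n)^`() = x ^+ n *+ n.
  rewrite deriv_exp derivXsubC mul1r; case: n => [|n] /=; first by rewrite !mulr0n mulr0.
  by rewrite mulrnAr -exprS.
have -> : x * wronsk D e (u * x ^+ s) (v * x ^+ t) =
  ((u * x ^+ s) * (v^`() * x ^+ t * x + v * (x * (x ^+ t)^`()))) *+ D -
  ((u^`() * x ^+ s * x + u * (x * (x ^+ s)^`())) * (v * x ^+ t)) *+ e.
  by rewrite /wronsk !derivM; ring.
by rewrite !dX /wronsk exprD !mulrnA; ring.
Qed.

Lemma horner_order (u v w : {poly K}) z i j :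
  (u * v *+ i - u * v *+ j + ('X - z%:P) * w).[z] = u.[z] * v.[z] * (i%:R - j%:R).
Proof.
rewrite hornerD (hornerM ('X - _)) hornerXsubC subrr mul0r hornerD hornerN !hornerMn hornerM.
by ring.
Qed.

Lemma mup_decomp p z : p != 0 -> exists2 u, ~~ root u z & p = u * ('X - z%:P) ^+ mup z p.
Proof.
move=> p0; have [n [u]] := multiplicity_XsubC p z; rewrite p0 /= => ru ep.
exists u => //; rewrite {1}ep; congr (_ * _ ^+ _).
by rewrite ep mupMr // mup_XsubCX eqxx.
Qed.

Lemma wronsk_mup0 D e p q z : p != 0 -> q != 0 -> wronsk D e p q = 0 ->
  (D * mup z q = e * mup z p)%N.
Proof.
move=> p0 q0 w0; have [u ru ep] := mup_decomp z p0; have [v rv eq] := mup_decomp z q0.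
have := wronsk_XsubC D e u v z (mup z p) (mup z q); rewrite /= -ep -eq w0 mulr0.
move/esym/eqP; rewrite mulf_eq0 expf_eq0 polyXsubC_eq0 andbF orbF => /eqP/(congr1 (horner^~ z)).
rewrite horner_order horner0 => /eqP.
rewrite !mulf_eq0 -!/(root _ _) (negPf ru) (negPf rv) /= subr_eq0 => /eqP.
exact: natK_inj.
Qed.

(** With s and t the multiplicities of z in p and q, the order of the Wronskian is s + t - 1, unless
    D t = e s makes the first term cancel; then it is at least s + t. *)
Lemma wronsk_mup D e p q z : p != 0 -> q != 0 -> wronsk D e p q != 0 ->
  if (D * mup z q == e * mup z p)%N
  then is_true (mup z p + mup z q < (mup z (wronsk D e p q)).+1)%N
  else ((mup z (wronsk D e p q)).+1 = mup z p + mup z q)%N.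
Proof.
move=> p0 q0 w0; have [u ru ep] := mup_decomp z p0; have [v rv eq] := mup_decomp z q0.
have := wronsk_XsubC D e u v z (mup z p) (mup z q); rewrite /= -ep -eq.
set W := _ + _ + _; have X0 : 'X - z%:P != 0 :> {poly K} by rewrite polyXsubC_eq0.
move=> eW; have W0 : W != 0.
  apply: contraNneq w0 => W0; move: eW; rewrite W0 mul0r => /eqP.
  by rewrite mulf_eq0 (negPf X0).
have emu : ((mup z (wronsk D e p q)).+1 = mup z W + (mup z p + mup z q))%N.
  move/(congr1 (mup z)): eW; rewrite !mupM ?expf_neq0 // mup_XsubCX eqxx => <-.
  by have := mup_XsubCX 1 z z; rewrite expr1 eqxx => ->.
rewrite emu; case: ifP => h; last first.
  rewrite mupNroot //; rewrite /root /W horner_order.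
  rewrite !mulf_neq0 // subr_eq0; apply: contraFneq h => /(natK_inj char0) ->; exact: eqxx.
rewrite -[X in (X < _)%N]add0n ltn_add2r -XsubC_dvd // dvdp_XsubCl.
by rewrite /root /W (eqP h) subrr add0r hornerM !hornerE subrr mul0r.
Qed.

Lemma sum_count_uniq (U r : seq K) : uniq U ->
  (\sum_(z <- U) count_mem z r = \sum_(x <- r) (x \in U))%N.
Proof.
move=> uU; under eq_bigr => z _ do rewrite -sum1_count big_mkcond /=.
rewrite exchange_big /=; apply: eq_bigr => x _.
rewrite -count_uniq_mem // -sum1_count [RHS]big_mkcond /=.
by apply: eq_bigr => z _; rewrite eq_sym; case: (x == z).
Qed.

(* If p, q and mu = wronsk D e0 p q have multiplicities s, t and m at a root of p, the second
   Wronskian gives D m = e s, while m = s + t - 1 unless D t = e0 s; so D t + S s = e0 s + D.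
   Summing over the roots and comparing with the degrees bounds their number. *)
Lemma few_roots (D e0 e S : nat) p q (r : seq K) :
  (0 < D)%N -> (0 < S)%N -> (D + e0 = e + S)%N ->
  p != 0 -> p = lead_coef p *: \prod_(z <- r) ('X - z%:P) ->
  wronsk D e0 p q != 0 -> wronsk D e p (wronsk D e0 p q) = 0 ->
  (size (undup r) <= 1)%N \/ (D * size (undup r) <= size r * S)%N.
Proof.
move=> D0 S0 eS p0 ep w0 ww0.
have q0 : q != 0 by apply: contraNneq w0 => ->; rewrite /wronsk deriv0 !mulr0 !mul0rn subrr.
have sp : (size p).-1 = size r.
  by rewrite ep size_scale ?lead_coef_eq0 // size_prod_XsubC.
have mp z : mup z p = count_mem z r.
  rewrite ep -mul_polyC mupMr ?mu_prod_XsubC //.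
  by rewrite /root hornerC lead_coef_eq0.
have [rq eq] := closed_field_poly_normal q.
have sq : (size q).-1 = size rq.
  by rewrite eq size_scale ?lead_coef_eq0 // size_prod_XsubC.
have mq z : mup z q = count_mem z rq.
  rewrite eq -mul_polyC mupMr ?mu_prod_XsubC //.
  by rewrite /root hornerC lead_coef_eq0.
(* The exceptional case D t = e0 s cannot occur: there m >= s + t, so D m >= (D + e0) s = (e + S) s
   > e s, as S and s are positive. *)
have loc z : z \in undup r ->
    (D * count_mem z rq + S * count_mem z r = e0 * count_mem z r + D)%N.
  rewrite mem_undup -has_pred1 has_count => s0.
  have := wronsk_mup0 z p0 w0 ww0; have := wronsk_mup z p0 q0 w0; rewrite mp mq.
  move: s0; move: (count_mem z r) (count_mem z rq) (mup _ _) => s t m s0.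
  by case: eqP => [h1 h2 h3|_ h2 h3]; nia.
have sumr : (\sum_(z <- undup r) count_mem z r = size r)%N.
  rewrite sum_count_uniq ?undup_uniq // -sum1_size; apply: eq_big_seq => z zr.
  by rewrite mem_undup zr.
have sumq : (\sum_(z <- undup r) count_mem z rq <= size rq)%N.
  rewrite sum_count_uniq ?undup_uniq // -sum1_size; apply: leq_sum => z _.
  exact: leq_b1.
have : (D * (\sum_(z <- undup r) count_mem z rq) + S * size r = e0 * size r + D * size (undup r))%N.
  rewrite -[in LHS]sumr -{1}sumr !big_distrr /= -big_split /= (eq_big_seq _ loc) big_split /=.
  by rewrite big_const_seq count_predT iter_addn_0.
have dw := wronsk_deg0 p0 w0 ww0.
(* If D deg q = e0 deg p, the summed identity gives D N <= S deg p for the number N of distinct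
   roots. Otherwise the degree of mu is known and D deg mu = e deg p, so D deg q + S deg p = e0 deg
   p + D and N <= 1. *)
case: (wronsk_deg p0 q0 w0) dw; rewrite sp sq; move: sumq;
  move: (\sum_(z <- _) _)%N (size (undup r)) (size r) (size rq) => T N n l h1.
  by move=> h2 _ h3; right; nia.
move=> h2; rewrite h2 => h3 h4; left; nia.
Qed.

End Univariate.

(** * Setting X = 1 in weighted homogeneous polynomials *)

Section Dehomogenization.
Variable K : closedFieldType.
Implicit Types (f g F G R : S1 K) (m : 'X_{1..2}).

Definition eval_at_X1 (f : S1 K) : {poly K} :=
  mmap (@polyC K) (fun i : 'I_2 => if i == 0 then 1 else 'X) f.

HB.instance Definition _ := GRing.RMorphism.copy eval_at_X1 eval_at_X1.

Definition dehom := locked eval_at_X1.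

Lemma dehom_rmorph : nmod_morphism dehom * monoid_morphism dehom.
Proof.
rewrite /dehom -lock; split; first by split=> [|x y]; rewrite ?rmorph0 ?rmorphD.
by split=> [|x y]; rewrite ?rmorph1 ?rmorphM.
Qed.

HB.instance Definition _ := GRing.isNmodMorphism.Build _ _ dehom dehom_rmorph.1.
HB.instance Definition _ := GRing.isMonoidMorphism.Build _ _ dehom dehom_rmorph.2.

Lemma dehomC c : dehom c%:MP = c%:P.
Proof. by rewrite /dehom -lock /eval_at_X1 mmapC. Qed.

Lemma dehomX : dehom varX = 1.
Proof. by rewrite /dehom -lock /eval_at_X1 mmapX mmap1U. Qed.

Lemma dehomY : dehom varY = 'X.
Proof. by rewrite /dehom -lock /eval_at_X1 mmapX mmap1U. Qed.

Lemma deriv_dehom f : (dehom f)^`() = dehom (mderiv 1 f).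
Proof.
elim/S1_ind: f => [c|||f g IHf IHg|f g IHf IHg].
- by rewrite dehomC mderivC rmorph0 derivC.
- by rewrite dehomX mderivX1 rmorph0 -polyC1 derivC.
- by rewrite dehomY mderivY1 rmorph1 derivX.
- by rewrite mderivD !rmorphD derivD /= IHf IHg.
- by rewrite mderivM rmorphD !rmorphM derivM /= IHf IHg.
Qed.

Lemma coef_dehomE f j : (dehom f)`_j = \sum_(m <- msupp f | m 1%R == j) f@_m.
Proof.
rewrite {1}(mpolyE f) rmorph_sum coef_sum [RHS]big_mkcond; apply: eq_bigr => m _ /=.
rewrite (monE m) -mul_mpolyC monX !rmorphM !rmorphXn /= dehomC dehomX dehomY mon1.
by rewrite expr1n mul1r coefCM coefXn eq_sym; case: eqP; rewrite ?mulr1 ?mulr0.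
Qed.

Lemma coef_dehom_neq0 f j : (dehom f)`_j != 0 -> exists2 i, f@_(mon i j) != 0 & true.
Proof.
rewrite coef_dehomE => n0; have : has (fun m => m 1%R == j) (msupp f).
  by apply: contraNT n0 => /hasPn h; rewrite big1_seq // => m /andP [e /h]; rewrite e.
case/hasP=> m; rewrite mcoeff_msupp => fm /eqP <-.
by exists (m 0%R) => //; rewrite -monE.
Qed.

(** As a > 0, the weight and the Y-exponent determine a monomial, so nothing cancels at X = 1. *)
Lemma coef_dehom a b d F m : (0 < a)%N -> whom a b d F -> wt a b m = d ->
  (dehom F)`_(m 1%R) = F@_m.
Proof.
move=> a0 hF wm; have uniq_m m' : F@_m' != 0 -> m' 1%R = m 1%R -> m' = m.
  move=> /hF; rewrite -wm /wt => e1 e2; rewrite (monE m) (monE m') e2; congr mon.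
  by apply/eqP; rewrite -(eqn_pmul2l a0); apply/eqP; rewrite e2 in e1; lia.
rewrite coef_dehomE; case: (boolP (m \in msupp F)) => [mF|nF].
  rewrite big_mkcond (bigD1_seq m) //= eqxx big1_seq ?addr0 // => m' /andP [ne].
  rewrite mcoeff_msupp => /uniq_m em; case: eqP => // /em e.
  by rewrite e eqxx in ne.
rewrite big1_seq; first by apply/esym/eqP; rewrite mcoeff_eq0.
move=> m' /andP [/eqP e]; rewrite mcoeff_msupp => F0; have em := uniq_m _ F0 e.
by rewrite mcoeff_msupp -em F0 in nF.
Qed.

Lemma dehom_inj a b d F : (0 < a)%N -> whom a b d F -> dehom F = 0 -> F = 0.
Proof.
move=> a0 hF d0; apply/mpolyP=> m; rewrite mcoeff0; apply/eqP; apply/negPn/negP=> Fm.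
by case/negP: (Fm); rewrite -(coef_dehom a0 hF (hF _ Fm)) d0 coef0.
Qed.

Lemma euler a b d F : whom a b d F ->
  F *+ d = (varX * mderiv 0 F) *+ a + (varY * mderiv 1 F) *+ b.
Proof.
move=> hF; apply/mpolyP=> m; rewrite mcoeffD !mcoeffMn coef_XdX coef_YdY.
case: (eqVneq F@_m 0) => [->|/hF <-]; first by rewrite !mul0rn addr0.
by rewrite /wt mulrnDr !mulrnA; congr (_ + _); rewrite -!mulrnA mulnC.
Qed.

(** Euler's identity expresses a times the X-derivative at X = 1 through the form and its
    Y-derivative; the terms with b cancel. *)
Lemma dehom_bracket a b d e F R : whom a b d F -> whom a b e R ->
  dehom (bracket F R) *+ a = wronsk d e (dehom F) (dehom R).
Proof.
move=> hF hR; rewrite /wronsk !deriv_dehom.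
have eF : dehom F *+ d = dehom (mderiv 0 F) *+ a + ('X * dehom (mderiv 1 F)) *+ b.
  by rewrite -rmorphMn (euler hF) rmorphD !rmorphMn !rmorphM /= dehomX dehomY mul1r.
have eR : dehom R *+ e = dehom (mderiv 0 R) *+ a + ('X * dehom (mderiv 1 R)) *+ b.
  by rewrite -rmorphMn (euler hR) rmorphD !rmorphMn !rmorphM /= dehomX dehomY mul1r.
rewrite -mulrnAl -mulrnAr eF eR /bracket rmorphB !rmorphM /=; ring.
Qed.

Hypothesis char0 : [pchar K] =i pred0.

(** The zero bracket becomes a zero Wronskian, so F(1, Y)^e and G(1, Y)^d have equal logarithmic
    derivatives and are proportional; both powers have weight d e, which lifts the relation back. *)
Lemma centr_homog a b d e F G : (0 < a)%N -> (0 < d)%N -> F != 0 ->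
  whom a b d F -> whom a b e G -> bracket F G = 0 -> exists c, G ^+ d = c *: F ^+ e.
Proof.
move=> a0 d0 F0 hF hG FG0; have w0 : wronsk d e (dehom F) (dehom G) = 0.
  by rewrite -(dehom_bracket hF hG) FG0 rmorph0 mul0rn.
case: (eqVneq G 0) => [->|G0]; first by exists 0; rewrite scale0r expr0n; case: d d0 {hF w0}.
have p0 : dehom F != 0 by apply: contra_neq F0; apply: dehom_inj hF.
have q0 : dehom G != 0 by apply: contra_neq G0; apply: dehom_inj hG.
have [||c ec] := @wronsk_const _ char0 (dehom F ^+ e) (dehom G ^+ d); first by rewrite expf_neq0.
  (* Times p q, the Wronskian of p^e and q^d equals p^e q^d times [wronsk d e p q]. *)
  apply: (@mulfI _ (dehom F * dehom G)); first by rewrite mulf_neq0.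
  have dX (p : {poly K}) n : p * (p ^+ n)^`() = (p ^+ n * p^`()) *+ n.
    rewrite deriv_exp; case: n => [|n]; rewrite ?mulr0n ?mulr0 //= exprS; ring.
  have -> : dehom F * dehom G * wronsk 1 1 (dehom F ^+ e) (dehom G ^+ d) =
     dehom F * dehom F ^+ e * (dehom G * (dehom G ^+ d)^`())
     - dehom F * (dehom F ^+ e)^`() * (dehom G * dehom G ^+ d) by rewrite /wronsk; ring.
  rewrite !dX mulr0 -[RHS](mulr0 (dehom F ^+ e * dehom G ^+ d)) -w0 /wronsk; ring.
exists c; apply/eqP; rewrite -subr_eq0; apply/eqP; apply: (@dehom_inj a b (e * d)%N) => //.
  rewrite -scaleN1r; apply: whomD; last by do 2 apply: whomZ; exact: whomX.
  by rewrite mulnC; exact: whomX.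
by rewrite rmorphB -mul_mpolyC rmorphM !rmorphXn /= dehomC ec mul_polyC subrr.
Qed.

End Dehomogenization.

(** * From a nilpotency relation to a homogeneous one *)

Section Tame.
Variable K : closedFieldType.
Hypothesis char0 : [pchar K] =i pred0.
Variables a b : nat.
Hypotheses (a0 : (0 < a)%N) (b0 : (0 < b)%N).
Implicit Types (f g F G R : S1 K) (m : 'X_{1..2}).

Local Notation wdeg := (wdeg a b).
Local Notation wlead := (wlead a b).
Local Notation whom := (whom a b).

Lemma wdegC c : wdeg (c%:MP : S1 K) = 0.
Proof. by rewrite /wdeg PhiC size_polyC; case: eqP. Qed.

Lemma wleadC c : wlead (c%:MP : S1 K) = c%:MP.
Proof. by rewrite /wlead PhiC lead_coefC. Qed.

Lemma wdegZ c f : c != 0 -> wdeg (c *: f) = wdeg f.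
Proof.
case: (eqVneq f 0) => [->|f0] c0; first by rewrite scaler0.
by rewrite -mul_mpolyC wdegM ?mpolyC_eq0 // wdegC.
Qed.

Lemma wleadZ c f : wlead (c *: f) = c *: wlead f.
Proof. by rewrite -mul_mpolyC wleadM wleadC mul_mpolyC. Qed.

Lemma wdeg0_const f : wdeg f = 0%N -> f = (f@_0%MM)%:MP.
Proof.
move=> d0; apply/mpolyP=> m; rewrite mcoeffC; case: (eqVneq m 0%MM) => [->|m0]; rewrite ?mulr1 // mulr0.
apply/eqP; apply: contraT => /(@wdeg_ge _ a b); rewrite d0 leqn0 /wt addn_eq0 !muln_eq0.
rewrite !eqn0Ngt a0 b0 /= -!eqn0Ngt => /andP [/eqP e1 /eqP e2]; case/eqP: m0.
by rewrite (monE m) e1 e2; apply/mnmP=> l; rewrite mnm0E; case: (ord2P l) => ->; rewrite ?mon0 ?mon1.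
Qed.

Lemma wdeg_gt0 f g : bracket f g != 0 -> (0 < wdeg f)%N.
Proof.
move=> n0; rewrite lt0n; apply: contraNneq n0 => /wdeg0_const ->.
by rewrite bracket_antisym bracketC oppr0.
Qed.

Lemma wdeg_sub_lt f g : wdeg f = wdeg g -> wlead f = wlead g -> f - g != 0 ->
  (wdeg (f - g) < wdeg f)%N.
Proof.
move=> ed el h0; have le : (wdeg (f - g) <= wdeg f)%N.
  apply: wdeg_le => m; rewrite mcoeffB; case: (eqVneq f@_m 0) => [->|/wdeg_ge //].
  by rewrite sub0r oppr_eq0 ed => /wdeg_ge.
rewrite ltn_neqAle le andbT; apply/eqP=> e; have [m + wm] := @wdeg_ex _ a b _ h0.
rewrite mcoeffB subr_eq0 => /eqP; apply; have := congr1 (mcoeff m) el.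
by rewrite !coef_wlead -ed -e wm eqxx.
Qed.

(* When L(g) Poisson-commutes with L(f), some power of g can be replaced by g^d - c f^e,
   which lowers the defect w(f) + w(g) - w({f,g}). *)
Lemma homog_nil_witness f g : bracket f g != 0 -> bracket (wlead f) (wlead (bracket f g)) = 0 ->
  exists e R, [/\ whom e R, bracket (wlead f) R != 0 & bracket (wlead f) (bracket (wlead f) R) = 0].
Proof.
(* The induction is on n, a strict upper bound for the defect; n = 0 contradicts
   [wdeg_bracket_le]. *)
have [n lt] : exists n, (wdeg f + wdeg g < wdeg (bracket f g) + n)%N.
  by exists (wdeg f + wdeg g).+1; rewrite ltn_addl.
move=> fg0 L0; elim: n g lt fg0 L0 => [|n IH] g lt fg0 L0.
  by have := wdeg_bracket_le a b fg0; lia.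
case: (eqVneq (bracket (wlead f) (wlead g)) 0) => [Lg0|Lg0]; last first.
  exists (wdeg g), (wlead g); split=> //; first exact: whom_wlead.
  by have [<- _] := wlead_bracket Lg0.
have f0 : f != 0 by apply: contraNneq fg0 => ->; rewrite bracket_antisym bracket0r oppr0.
have g0 : g != 0 by apply: contraNneq fg0 => ->; rewrite bracket0r.
have d0 : (0 < wdeg f)%N := wdeg_gt0 fg0.
have Lf0 : wlead f != 0 by rewrite wlead_eq0.
have [c ec] := centr_homog char0 a0 d0 Lf0 (@whom_wlead _ a b f) (@whom_wlead _ a b g) Lg0.
have c0 : c != 0.
  apply: contra_eq_neq ec => ->; rewrite scale0r expf_neq0 // wlead_eq0 //.
pose g' := g ^+ wdeg f - c *: f ^+ wdeg g.
have fg' : bracket f g' = (wdeg f)%:R *: (g ^+ (wdeg f).-1 * bracket f g).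
  rewrite /g' -scaleN1r bracketDr !bracketZr !bracketXnr bracketff mulr0 mul0rn !scaler0 addr0.
  by rewrite scaler_nat.
have n0 : ((wdeg f)%:R : K) != 0 by rewrite natK_eq0 // -lt0n.
have fg'0 : bracket f g' != 0.
  by rewrite fg' scaler_eq0 (negPf n0) mulf_neq0 // expf_neq0.
have g'0 : g' != 0 by apply: contraNneq fg'0 => ->; rewrite bracket0r.
have ltg' : (wdeg g' < wdeg f * wdeg g)%N.
  rewrite -wdegX //; apply: wdeg_sub_lt => //.
    by rewrite wdegZ // !wdegX // mulnC.
  by rewrite wleadZ !wleadX.
(* With d = w(f), the bracket {f, g'} is a nonzero multiple of g^(d-1) {f, g}, while w(g') < d w(g):
   the defect drops. Both factors of L({f, g'}) commute with L(f). *)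
apply: (IH g') => //.
  rewrite fg' wdegZ // wdegM ?expf_neq0 // wdegX //.
  move: lt ltg' d0; case: (wdeg f) => // d; rewrite /= mulSn; move: (d * wdeg g)%N => x; lia.
rewrite fg' wleadZ wleadM wleadX bracketZr bracketMr bracketXnr Lg0 L0.
by rewrite !mulr0 mul0rn mul0r addr0 scaler0.
Qed.

End Tame.

(** * Root bounds for leading forms of nilpotent or semisimple elements *)

Section TameElements.
Variable K : closedFieldType.
Hypothesis char0 : [pchar K] =i pred0.
Implicit Types (f g F G R : S1 K).

Definition nil_witness f : Prop :=
  exists g, bracket f g != 0 /\ bracket f (bracket f g) = 0.

Definition eig_witness f : Prop :=
  exists (l : K) g, [/\ l != 0, g != 0 & bracket f g = l *: g].

(** The consequence of nilpotency or semisimplicity that the reduction to rectangular form rests on;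
    being existential, it is easily transported along automorphisms. *)
Definition tame f : Prop := nil_witness f \/ eig_witness f.

Variables a b : nat.
Hypotheses (a0 : (0 < a)%N) (b0 : (0 < b)%N).

(** For an eigenvector g, either L(f) and L(g) commute and [homog_nil_witness] applies, or comparing
    weights in {f, g} = l g gives w(f) + w(g) = w(g) + a + b. *)
Lemma tame_homog f : tame f -> wdeg a b f = (a + b)%N \/
  exists e R, [/\ whom a b e R, bracket (wlead a b f) R != 0 &
                  bracket (wlead a b f) (bracket (wlead a b f) R) = 0].
Proof.
case=> [[g [fg0 ffg0]]|[l [g [l0 g0 fg]]]].
  by right; apply: homog_nil_witness fg0 _ => //; apply: wlead_centr.
case: (eqVneq (bracket (wlead a b f) (wlead a b g)) 0) => [Lg0|Lg0].
  right; apply: (homog_nil_witness char0 a0 b0 (g := g)); first by rewrite fg scaler_eq0 negb_or l0.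
  by rewrite fg wleadZ bracketZr Lg0 scaler0.
left; have [_] := wlead_bracket Lg0; rewrite fg wdegZ //; lia.
Qed.

(** This is [few_roots] with D = w(f), S = a + b, and e0 and e the weights of R and {F, R}. *)
Lemma few_edge_roots f (r : seq K) : tame f -> f != 0 ->
  dehom (wlead a b f) = lead_coef (dehom (wlead a b f)) *: \prod_(z <- r) ('X - z%:P) ->
  [\/ wdeg a b f = (a + b)%N, (size (undup r) <= 1)%N |
      (wdeg a b f * size (undup r) <= size r * (a + b))%N].
Proof.
move=> /tame_homog [->|[e0 [R [hR FR0 FFR0]]]] f0 er; first by constructor 1.
have hF := @whom_wlead _ a b f; set F := wlead a b f in FR0 FFR0 hF er.
have F0 : F != 0 by rewrite wlead_eq0.
have [e eS hFR] := whom_bracket hF hR FR0.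
have inj G d : whom a b d G -> G != 0 -> dehom G != 0.
  by move=> hG; apply: contra_neq; apply: dehom_inj hG.
have w1 := dehom_bracket hF hR; have w2 := dehom_bracket hF hFR.
have D0 : (0 < wdeg a b f)%N.
  rewrite lt0n; apply: contraNneq FR0 => /(wdeg0_const a0 b0) fC.
  by rewrite /F fC wleadC bracket_antisym bracketC oppr0.
have S0 : (0 < a + b)%N by rewrite addn_gt0 a0.
case: (few_roots char0 D0 S0 (esym eS) (inj _ _ hF F0) er _ _ (q := dehom R)).
- by rewrite -w1 -scaler_nat scaler_eq0 natK_eq0 // negb_or -lt0n a0; apply: inj hFR FR0.
- rewrite -w1; have -> : wronsk (wdeg a b f) e (dehom F) (dehom (bracket F R) *+ a) =
    wronsk (wdeg a b f) e (dehom F) (dehom (bracket F R)) *+ a.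
    by rewrite /wronsk derivMn; ring.
  by rewrite -w2 FFR0 rmorph0 !mul0rn.
- by constructor 2.
by constructor 3.
Qed.

End TameElements.

(** * Symplectic automorphisms and their action on leading forms *)

Section Automorphisms.
Variable K : closedFieldType.
Implicit Types (f g F G : S1 K) (phi psi : {lrmorphism S1 K -> S1 K}).

Definition subst_lr (P Q : S1 K) : {lrmorphism S1 K -> S1 K} := comp_mpoly [tuple P; Q].

Lemma subst_lrX P Q : subst_lr P Q varX = P.
Proof. by rewrite /= /varX comp_mpolyXU. Qed.

Lemma subst_lrY P Q : subst_lr P Q varY = Q.
Proof. by rewrite /= /varY comp_mpolyXU. Qed.

Lemma lrmorphC phi c : phi c%:MP = c%:MP.
Proof. by rewrite -[c%:MP]mulr1 mul_mpolyC linearZ rmorph1. Qed.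

Lemma lrmorphD phi f g : phi (f + g) = phi f + phi g.
Proof. exact: rmorphD. Qed.

Lemma lrmorphN phi f : phi (- f) = - phi f.
Proof. exact: rmorphN. Qed.

Lemma lrmorphM phi f g : phi (f * g) = phi f * phi g.
Proof. exact: rmorphM. Qed.

Lemma lrmorphXn phi f n : phi (f ^+ n) = phi f ^+ n.
Proof. exact: rmorphXn. Qed.

Lemma lrmorphZ phi c f : phi (c *: f) = c *: phi f.
Proof. exact: linearZ. Qed.

Lemma lrmorph_ext phi psi : phi varX = psi varX -> phi varY = psi varY -> phi =1 psi.
Proof.
move=> hX hY; elim/S1_ind => [c|||f g hf hg|f g hf hg] //; first by rewrite !lrmorphC.
  by rewrite !rmorphD /= hf hg.
by rewrite !rmorphM /= hf hg.
Qed.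

Lemma lrmorph_id phi : phi varX = varX -> phi varY = varY -> phi =1 id.
Proof. by move=> hX hY; apply: (@lrmorph_ext phi (idfun : {lrmorphism S1 K -> S1 K})). Qed.

Lemma cancel_XY phi psi : phi (psi varX) = varX -> phi (psi varY) = varY -> cancel psi phi.
Proof. exact: (@lrmorph_id (phi \o psi : {lrmorphism S1 K -> S1 K})). Qed.

Lemma chain_rule phi i f : mderiv i (phi f) =
  phi (mderiv 0 f) * mderiv i (phi varX) + phi (mderiv 1 f) * mderiv i (phi varY).
Proof.
elim/S1_ind: f => [c|||f g hf hg|f g hf hg].
- by rewrite lrmorphC !mderivC rmorph0; ring.
- by rewrite mderivX0 mderivX1 rmorph0 rmorph1; ring.
- by rewrite mderivY0 mderivY1 rmorph0 rmorph1; ring.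
- by rewrite !rmorphD !mderivD /= hf hg; ring.
- by rewrite !rmorphM !mderivM /= hf hg !rmorphD !rmorphM /=; ring.
Qed.

(** An endomorphism multiplies brackets by its Jacobian, so preserving them amounts to {phi X, phi
    Y} = 1. *)
Lemma bracket_lrmorph phi f g :
  bracket (phi f) (phi g) = phi (bracket f g) * bracket (phi varX) (phi varY).
Proof.
rewrite /bracket rmorphB !rmorphM /= !(chain_rule phi _ f) !(chain_rule phi _ g); ring.
Qed.

Lemma isAut_cancel phi psi : bracket (phi varX) (phi varY) = 1 ->
  cancel phi psi -> cancel psi phi -> isAut phi.
Proof.
by move=> h1 h2 h3; split; [exists psi | move=> f g; rewrite bracket_lrmorph h1 mulr1].
Qed.

Lemma isAut_sub phi psi : bracket (phi varX) (phi varY) = 1 ->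
  psi (phi varX) = varX -> psi (phi varY) = varY ->
  phi (psi varX) = varX -> phi (psi varY) = varY -> isAut phi.
Proof.
by move=> h1 h2 h3 h4 h5; apply: (isAut_cancel h1 (psi := psi)); apply: cancel_XY.
Qed.

Lemma isAut_bracketXY phi : isAut phi -> bracket (phi varX) (phi varY) = 1.
Proof. by case=> _ <-; rewrite bracketXY rmorph1. Qed.

Lemma isAut_inj phi : isAut phi -> injective phi.
Proof. by case=> /bij_inj. Qed.

Lemma isAut_eq0 phi f : isAut phi -> (phi f == 0) = (f == 0).
Proof. by move=> /isAut_inj h; rewrite -{1}(rmorph0 phi) (inj_eq h). Qed.

Lemma isAut_comp phi psi : isAut phi -> isAut psi ->
  isAut (phi \o psi : {lrmorphism S1 K -> S1 K}).
Proof.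
case=> b1 h1 [b2 h2]; split; first exact: bij_comp.
by move=> f g; rewrite /= h2 h1.
Qed.

(** Bijectivity only provides an inverse function; the inverse morphism is rebuilt as the
    substitution of its values at X and Y. *)
Lemma isAut_inv phi : isAut phi -> exists psi, [/\ isAut psi, cancel phi psi & cancel psi phi].
Proof.
move=> aut; have [[h hK Kh] br] := aut; pose psi := subst_lr (h varX) (h varY).
have K1 : cancel psi phi by apply: cancel_XY; rewrite ?subst_lrX ?subst_lrY Kh.
have K2 : cancel phi psi by move=> f; apply: (isAut_inj aut); rewrite K1.
exists psi; split=> //; apply: (isAut_cancel _ K1 K2).
by apply: (isAut_inj aut); rewrite br !K1 bracketXY rmorph1.
Qed.

Lemma equivS1_sym f g : equivS1 f g -> equivS1 g f.
Proof.
case=> phi [/isAut_inv [psi [a1 K1 K2]] ->]; by exists psi.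
Qed.

Lemma equivS1_trans f g h : equivS1 f g -> equivS1 g h -> equivS1 f h.
Proof.
case=> phi [a1 ->] [psi [a2 ->]].
by exists (psi \o phi : {lrmorphism S1 K -> S1 K}); split=> //; apply: isAut_comp.
Qed.

Lemma equivS1_aut phi f : isAut phi -> equivS1 f (phi f).
Proof. by move=> h; exists phi. Qed.

Lemma nil_witness_equiv f g : equivS1 f g -> nil_witness f -> nil_witness g.
Proof.
case=> phi [aut ->] [h [h0 hh]]; have [_ br] := aut.
by exists (phi h); rewrite -!br hh rmorph0 isAut_eq0.
Qed.

Lemma eig_witness_equiv f g : equivS1 f g -> eig_witness f -> eig_witness g.
Proof.
case=> phi [aut ->] [l [h [l0 h0 hh]]]; have [_ br] := aut.
by exists l, (phi h); rewrite -br hh lrmorphZ isAut_eq0.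
Qed.

Lemma tame_equiv f g : equivS1 f g -> tame f -> tame g.
Proof.
by move=> h [/(nil_witness_equiv h)|/(eig_witness_equiv h)]; [left | right].
Qed.

Definition shearY (c : K) j : {lrmorphism S1 K -> S1 K} :=
  subst_lr varX (varY + c *: varX ^+ j).

Definition shearX (c : K) j : {lrmorphism S1 K -> S1 K} :=
  subst_lr (varX + c *: varY ^+ j) varY.

Definition swap : {lrmorphism S1 K -> S1 K} := subst_lr varY (- varX).

Definition scaling (c d : K) : {lrmorphism S1 K -> S1 K} :=
  subst_lr (c *: varX + d%:MP) (c^-1 *: varY).

Lemma isAut_shearY c j : isAut (shearY c j).
Proof.
apply: (@isAut_sub _ (shearY (- c) j)); rewrite ?subst_lrX ?subst_lrY //.
- rewrite bracketDr bracketXY bracketZr bracketXnr bracketff mulr0 mul0rn scaler0.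
  by rewrite addr0.
- by rewrite lrmorphD lrmorphZ lrmorphXn !subst_lrX subst_lrY scaleNr subrK.
- by rewrite lrmorphD lrmorphZ lrmorphXn !subst_lrX subst_lrY scaleNr addrK.
Qed.

Lemma isAut_shearX c j : isAut (shearX c j).
Proof.
apply: (@isAut_sub _ (shearX (- c) j)); rewrite ?subst_lrX ?subst_lrY //.
- rewrite bracket_antisym bracketDr bracketZr bracketXnr bracketff mulr0 mul0rn scaler0.
  by rewrite addr0 -bracket_antisym bracketXY.
- by rewrite lrmorphD lrmorphZ lrmorphXn !subst_lrX !subst_lrY scaleNr subrK.
- by rewrite lrmorphD lrmorphZ lrmorphXn !subst_lrX !subst_lrY scaleNr addrK.
Qed.

Lemma isAut_swap : isAut swap.
Proof.
apply: (@isAut_sub _ (subst_lr (- varY) varX)); rewrite ?subst_lrX ?subst_lrY ?lrmorphN ?subst_lrX ?subst_lrY ?opprK //.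
by rewrite -scaleN1r bracketZr scaleN1r -bracket_antisym bracketXY.
Qed.

Lemma isAut_scaling c d : c != 0 -> isAut (scaling c d).
Proof.
move=> c0; apply: (@isAut_sub _ (subst_lr (c^-1 *: varX - (c^-1 * d)%:MP) (c *: varY)));
  rewrite ?subst_lrX ?subst_lrY.
- rewrite bracketZr bracket_antisym bracketDr bracketZr bracketC addr0 -scalerN -bracket_antisym.
  by rewrite bracketXY scalerA mulVf // scale1r.
- rewrite lrmorphD lrmorphZ lrmorphC subst_lrX scalerBr scalerA mulfV // scale1r.
  by rewrite -mul_mpolyC -mpolyCM mulrA mulfV // mul1r subrK.
- by rewrite lrmorphZ subst_lrY scalerA mulVf // scale1r.
- rewrite lrmorphD lrmorphN lrmorphZ lrmorphC subst_lrX scalerDr scalerA mulVf // scale1r.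
  by rewrite -mul_mpolyC -mpolyCM addrK.
- by rewrite lrmorphZ subst_lrY scalerA mulfV // scale1r.
Qed.

Section Homogeneous.
Variables (a b : nat) (phi : {lrmorphism S1 K -> S1 K}).
Hypotheses (hX : whom a b a (phi varX)) (hY : whom a b b (phi varY)).

(** A substitution that keeps the weights of X and Y commutes with the grading; if injective, it
    therefore preserves weighted degrees and carries leading forms to leading forms. *)
Lemma Phi_lrmorph f : Phi a b (phi f) = map_poly phi (Phi a b f).
Proof.
elim/S1_ind: f => [c|||f g hf hg|f g hf hg].
- by rewrite lrmorphC !PhiC map_polyC /= lrmorphC.
- by rewrite PhiVX rmorphM /= map_polyC map_polyXn; move/whomP: hX.
- by rewrite PhiVY rmorphM /= map_polyC map_polyXn; move/whomP: hY.
- by rewrite !rmorphD /= hf hg.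
- by rewrite !rmorphM /= hf hg.
Qed.

Hypothesis inj : injective phi.

Lemma wdeg_lrmorph f : wdeg a b (phi f) = wdeg a b f.
Proof. by rewrite /wdeg Phi_lrmorph size_map_inj_poly ?rmorph0. Qed.

Lemma wlead_lrmorph f : wlead a b (phi f) = phi (wlead a b f).
Proof. by rewrite /wlead Phi_lrmorph lead_coef_map_inj ?rmorph0. Qed.

End Homogeneous.

End Automorphisms.

(** * Making the form of top total degree a monomial *)

Section Existence.
Variable K : closedFieldType.
Hypothesis char0 : [pchar K] =i pred0.
Implicit Types (f g F : S1 K) (r : seq K).

Local Notation tdeg := (wdeg 1 1).
Local Notation top := (wlead 1 1).

Lemma tame_bracket f : tame f -> exists g, bracket f g != 0.
Proof.
case=> [[g [h _]]|[l [g [l0 g0 e]]]]; exists g => //.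
by rewrite e scaler_eq0 negb_or l0.
Qed.

Lemma tame_neq0 f : tame f -> f != 0.
Proof.
case/tame_bracket=> g; apply: contraNneq => ->.
by rewrite bracket_antisym bracket0r oppr0.
Qed.

Lemma undup2 r : (size (undup r) <= 2)%N ->
  exists z1 z2, forall z, z \in r -> z = z1 \/ z = z2.
Proof.
case e : (undup r) => [|z1 [|z2 [|//]]] _; [exists 0, 0 | exists z1, z1 | exists z1, z2];
  move=> z; rewrite -mem_undup e ?in_nil // ?inE.
  by move/eqP; left.
by case/orP=> /eqP; [left | right].
Qed.

Lemma undup1 r : (size (undup r) <= 1)%N -> exists z, r = nseq (size r) z.
Proof.
move=> h; have [z1 hz] : exists z1, forall z, z \in r -> z = z1.
  case e : (undup r) h => [|z1 [|//]] _; [exists 0 | exists z1] => z;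
    by rewrite -mem_undup e ?in_nil // mem_seq1 => /eqP.
by exists z1; apply/all_pred1P/allP=> z /hz ->; rewrite /= eqxx.
Qed.

Lemma whom_varXn a b n : whom a b (a * n) (varX ^+ n : S1 K).
Proof. by rewrite mulnC; apply: whomX; exact: whom_varX. Qed.

(** For the weights (a, a t) each Y - z X^t is homogeneous, so the factorization of F(1, Y)
    rehomogenizes; the power of X supplies the missing weight. *)
Lemma homog_factor a t d F (c : K) r : (0 < a)%N -> whom a (a * t) d F -> c != 0 ->
  dehom F = c *: \prod_(z <- r) ('X - z%:P) ->
  exists2 e, (a * e + a * t * size r = d)%N &
    F = c *: (varX ^+ e * \prod_(z <- r) (varY - z *: varX ^+ t)).
Proof.
move=> a0 hF c0 eF; have : (dehom F)`_(size r) != 0.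
  rewrite eF coefZ; have /monicP := @monic_prod_XsubC K _ r predT id.
  by rewrite lead_coefE size_prod_XsubC => ->; rewrite mulr1.
case/coef_dehom_neq0=> e /hF; rewrite /wt mon0 mon1 => ed _.
exists e => //; apply/eqP; rewrite -subr_eq0; apply/eqP.
have hprod : whom a (a * t) (a * t * size r) (\prod_(z <- r) (varY - z *: varX ^+ t)).
  elim: (r) => [|z s IH]; first by rewrite big_nil muln0 -mpolyC1; apply: whomC.
  rewrite big_cons mulnS; apply: whomM IH; apply: whomD; first exact: whom_varY.
  rewrite -scaleNr; apply: whomZ; exact: whom_varXn.
apply: (@dehom_inj _ a (a * t) d) => //.
  apply: whomD => //; rewrite -scaleNr; apply: whomZ; rewrite -ed; apply: whomM hprod.
  exact: whom_varXn.
rewrite rmorphB -[X in _ - _ X]mul_mpolyC !rmorphM rmorphXn rmorph_prod /= dehomC dehomX expr1n mul1r.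
apply/eqP; rewrite subr_eq0 eF -mul_polyC; apply/eqP; congr (_ * _); apply: eq_bigr => z _.
by rewrite rmorphB -mul_mpolyC rmorphM rmorphXn /= dehomC dehomX dehomY expr1n mulr1.
Qed.

Lemma shear_factor z t : shearY z t (varY - z *: varX ^+ t) = varY :> S1 K.
Proof. by rewrite lrmorphD lrmorphN lrmorphZ lrmorphXn !subst_lrX !subst_lrY addrK. Qed.

Lemma prod_two_roots (I : eqType) (s : seq I) (z1 z2 : I) (h : I -> S1 K) :
  (forall z, z \in s -> z = z1 \/ z = z2) ->
  exists k l, \prod_(z <- s) h z = h z1 ^+ k * h z2 ^+ l.
Proof.
elim: s => [|x s IH] hs; first by exists 0%N, 0%N; rewrite big_nil mul1r.
have [k [l e]] : exists k l, \prod_(z <- s) h z = h z1 ^+ k * h z2 ^+ l.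
  by apply: IH => z zs; apply: hs; rewrite inE zs orbT.
case: (hs x (mem_head _ _)) => ->; [exists k.+1, l | exists k, l.+1];
  by rewrite big_cons e exprS; ring.
Qed.

Lemma whom_shearX c : whom 1 1 1 (shearX c 1 varX : S1 K) /\ whom 1 1 1 (shearX c 1 varY : S1 K).
Proof.
rewrite subst_lrX subst_lrY expr1; split; last exact: whom_varY.
by apply: whomD; [exact: whom_varX | apply: whomZ; exact: whom_varY].
Qed.

Lemma whom_shearY a t c : whom a (a * t) a (shearY c t varX : S1 K) /\
  whom a (a * t) (a * t) (shearY c t varY : S1 K).
Proof.
rewrite subst_lrX subst_lrY; split; first exact: whom_varX.
apply: whomD; first exact: whom_varY.
by apply: whomZ; exact: whom_varXn.
Qed.

(** The top form has at most two distinct linear factors, counting X, and linear shears send these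
    to multiples of X and Y. *)
Lemma monomial_top f : tame f -> exists g c k l,
  [/\ equivS1 f g, tdeg g = tdeg f, c != 0 & top g = c *: 'X_[mon k l]].
Proof.
move=> tf; have f0 := tame_neq0 tf; have hF := @whom_wlead _ 1 1 f.
have F0 : top f != 0 by rewrite wlead_eq0.
have p0 : dehom (top f) != 0 by apply: contra_neq F0; apply: dehom_inj hF.
have [r er] := closed_field_poly_normal (dehom (top f)).
set c := lead_coef _ in er; have c0 : c != 0 by rewrite lead_coef_eq0.
have [e ed eF] := @homog_factor 1 1 _ _ _ _ isT hF c0 er.
rewrite !mul1n in ed; have few := few_edge_roots char0 (ltn0Sn 0) (ltn0Sn 0) tf f0 er.
have le_r := size_undup r.
have step1 z k (h : S1 K) : top f = c *: (varX ^+ e * ((varY - z *: varX ^+ 1) ^+ k * h)) ->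
   [/\ equivS1 f (shearY z 1 f), tdeg (shearY z 1 f) = tdeg f &
     top (shearY z 1 f) = c *: (varX ^+ e * (varY ^+ k * shearY z 1 h))].
  move=> eT; have aut := @isAut_shearY _ z 1; have [hX hY] := @whom_shearY 1 1 z.
  split; first exact: equivS1_aut.
    by rewrite (wdeg_lrmorph hX hY) //; apply: isAut_inj.
  rewrite (wlead_lrmorph hX hY); last exact: isAut_inj.
  by rewrite eT lrmorphZ !lrmorphM !lrmorphXn shear_factor subst_lrX.
case: (leqP (size (undup r)) 1) => [/undup1 [z ez]|lt1].
  have eT : top f = c *: (varX ^+ e * ((varY - z *: varX ^+ 1) ^+ size r * 1)).
    by rewrite eF {1}ez big_nseq -Monoid.iteropE mulr1.
  have [h1 h2 h3] := step1 _ _ _ eT; exists (shearY z 1 f), c, e, (size r); split=> //.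
  by rewrite h3 rmorph1 mulr1 monX.
(* Let d be the degree, n the number of roots and N >= 2 the number of distinct ones. Either d = 2
   or d N <= 2 n, and d = e + n; both give N = 2 and e = 0. *)
have [le2 e0] : (size (undup r) <= 2)%N /\ e = 0%N.
  by move: few le_r lt1 ed; move: (size _) (size _) => N n; rewrite -/(tdeg f); case; nia.
have [z1 [z2 hz]] := undup2 le2.
have [k [l ekl]] := prod_two_roots (fun z => varY - z *: varX ^+ 1) hz.
have [h1 h2 h3] := step1 z1 k ((varY - z2 *: varX ^+ 1) ^+ l) (etrans eF (congr1 _ (congr1 _ ekl))).
case: (eqVneq z1 z2) => [ez|nz].
  exists (shearY z1 1 f), c, 0%N, (k + l)%N; split=> //.
  by rewrite h3 lrmorphXn -ez shear_factor -exprD monX e0.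
(* The first shear turns the factors into Y and Y - s X; then X -> X + s^-1 Y fixes Y and sends Y -
   s X to - s X. *)
set s := z2 - z1; have s0 : s != 0 by rewrite subr_eq0 eq_sym.
have aut := @isAut_shearX _ s^-1 1; have [hX hY] := @whom_shearX s^-1.
exists (shearX s^-1 1 (shearY z1 1 f)), (c * (- s) ^+ l), l, k; split.
- by apply: equivS1_trans h1 _; apply: equivS1_aut.
- by rewrite (wdeg_lrmorph hX hY) //; apply: isAut_inj.
- by rewrite mulf_neq0 // expf_neq0 // oppr_eq0.
rewrite (wlead_lrmorph hX hY); last exact: isAut_inj.
have e1 : shearY z1 1 (varY - z2 *: varX ^+ 1) = varY - s *: varX :> S1 K.
  rewrite lrmorphD lrmorphN lrmorphZ lrmorphXn subst_lrX subst_lrY !expr1 /s scalerBl.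
  by rewrite opprB addrA.
have e2 : shearX s^-1 1 (varY - s *: varX) = (- s) *: varX :> S1 K.
  rewrite lrmorphD lrmorphN lrmorphZ subst_lrX subst_lrY expr1 scalerDr scalerA mulfV // scale1r.
  by rewrite scaleNr opprD addrCA subrr addr0.
rewrite h3 e0 expr0 mul1r lrmorphZ lrmorphM !lrmorphXn e1 e2 subst_lrY.
by rewrite exprZn -scalerAr scalerA monX; congr (_ *: _); exact: mulrC.
Qed.

End Existence.

(** * Lowering the total degree along an edge of the Newton polygon *)

Section Reduction.
Variable K : closedFieldType.
Hypothesis char0 : [pchar K] =i pred0.
Implicit Types (f g F : S1 K) (r : seq K) (m : 'X_{1..2}).

Local Notation tdeg := (wdeg 1 1).
Local Notation top := (wlead 1 1).

(** Maximizes the ratio u / v with denominators cleared; x0 witnesses that the list is nonempty. *)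
Lemma max_slope (T : eqType) (u v : T -> nat) (s : seq T) x0 : x0 \in s ->
  (forall x, x \in s -> 0 < v x)%N ->
  exists2 x, x \in s & forall y, y \in s -> (u y * v x <= u x * v y)%N.
Proof.
elim: s x0 => // z s IH x0 _ vp; case: s IH vp => [|x1 s] IH vp.
  by exists z; rewrite ?mem_head // => y; rewrite inE => /eqP ->.
have [x xs hx] := IH x1 (mem_head _ _) (fun x hx => vp x (@mem_behead _ (z :: x1 :: s) _ hx)).
have xs' : x \in z :: x1 :: s by rewrite inE xs orbT.
have vz := vp z (mem_head _ _); have vx := vp x xs'.
case: (leqP (u z * v x) (u x * v z)) => h; [exists x | exists z];
  rewrite ?mem_head // => y; rewrite inE => /orP [/eqP -> //|/hx hy] //.
rewrite -(leq_pmul2r vx); move: hy h; move: (u y) (v x) (u x) (v y) (u z) (v z); nia.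
Qed.

Lemma tdeg_monomial_top f c k l : top f = c *: 'X_[mon k l] -> c != 0 -> tdeg f = (k + l)%N.
Proof.
move=> tf c0; rewrite -(@whom_wlead _ 1 1 f (mon k l)) ?/wt ?mul1n ?mon0 ?mon1 //.
by rewrite tf mcoeffZ mcoeffX eqxx mulr1.
Qed.

Lemma coef_monomial_top f c k l m : top f = c *: 'X_[mon k l] -> c != 0 ->
  f@_m != 0 -> (m 0%R + m 1%R <= k + l)%N /\ ((m 0%R + m 1%R = k + l)%N -> m = mon k l).
Proof.
move=> tf c0 fm; have td := tdeg_monomial_top tf c0.
have := @wdeg_ge _ 1 1 _ _ fm; rewrite td /wt !mul1n => le; split=> // e.
have := coef_wlead 1 1 f m; rewrite td /wt !mul1n e eqxx tf mcoeffZ mcoeffX.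
by case: eqP => // _ /esym/eqP; rewrite mulr0 (negPf fm).
Qed.

Lemma coef_monomial_top_neq0 f c k l : top f = c *: 'X_[mon k l] -> c != 0 -> f@_(mon k l) != 0.
Proof.
move=> tf c0; have := coef_wlead 1 1 f (mon k l); rewrite tf mcoeffZ mcoeffX eqxx mulr1.
by move=> cE; apply: contraNneq c0 => f0; rewrite cE f0 if_same.
Qed.

(** Here n is the degree of F(1, Y) and N counts its distinct roots. The weight is at least b n with
    b > a: if it equals a + b, then n <= 1, and N >= 2 in the last alternative would give 2 b n <= n
    (a + b). *)
Lemma slope_arith (a b k l i n N : nat) : (a < b)%N -> (a * i + b * n = a * k + b * l)%N ->
  (N <= n)%N -> (l < n)%N ->
  [\/ (a * k + b * l = a + b)%N, (N <= 1)%N | ((a * k + b * l) * N <= n * (a + b))%N] ->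
  (N <= 1)%N.
Proof.
move=> ab <- Nn ln; case=> // h.
  by case: (leqP n 1) => [|n2]; [lia | have := leq_mul (leqnn b) n2; lia].
case: (leqP N 1) => // N2; have := leq_trans (leq_mul (leqnn _) N2) h.
have : (a * n < b * n)%N by rewrite ltn_pmul2r // (leq_ltn_trans (leq0n l) ln).
by lia.
Qed.

Lemma slope_arith0 (a b k l i : nat) : (a < b)%N -> (a * i = a * k + b * l)%N ->
  (i <= k + l)%N -> l = 0%N.
Proof.
move=> ab e le; have := leq_mul (leqnn a) le; rewrite e mulnDr leq_add2l.
by case: l {e le} => // l; rewrite leq_pmul2r // leqNgt ab.
Qed.

Lemma slope_arith2 (a t k i j : nat) : (0 < a)%N -> (1 < t)%N ->
  (a * i + a * t * j <= a * k)%N -> (i + j <= k)%N /\ ((i + j = k)%N -> j = 0%N).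
Proof.
move=> a0 t2; rewrite -mulnA -mulnDr leq_pmul2l // => le.
have := leq_mul t2 (leqnn j); lia.
Qed.

(* The edge of the Newton polygon through (k, l) and the farthest point above it carries,
   by few_edge_roots, a single binomial power, which a triangular automorphism removes. *)
Lemma tdeg_reduction f c k l m0 : tame f -> top f = c *: 'X_[mon k l] -> c != 0 ->
  f@_m0 != 0 -> (l < m0 1%R)%N -> exists2 g, equivS1 f g & (tdeg g < tdeg f)%N.
Proof.
move=> tf topf c0 fm0 lm0; have tdf := tdeg_monomial_top topf c0.
have inT := coef_monomial_top topf c0; have fkl := coef_monomial_top_neq0 topf c0.
have f0 := tame_neq0 tf.
pose s := [seq m : 'X_{1..2} <- msupp f | (l < m 1%R)%N].
have sE m : (m \in s) = (l < m 1%R)%N && (f@_m != 0) by rewrite mem_filter mcoeff_msupp.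
have below m : m \in s -> (m 0%R + m 1%R < k + l)%N.
  rewrite sE => /andP [lm /inT [le e]]; rewrite ltn_neqAle le andbT; apply/eqP=> /e em.
  by rewrite em mon1 ltnn in lm.
have [||m1 m1s slope] := @max_slope _ (fun m : 'X_{1..2} => (m 1%R - l)%N) (fun m => (k - m 0%R)%N) s m0.
- by rewrite sE lm0.
- by move=> m ms; have := below m ms; move: ms; rewrite sE => /andP [lm _]; lia.
have := m1s; rewrite sE => /andP [lm1 fm1]; have bm1 := below _ m1s.
(* These weights put (k, l) and m1 on one line a x + b y = const, and a < b because m1 has total
   degree below k + l. *)
set a := (m1 1%R - l)%N in slope; set b := (k - m1 0%R)%N in slope.
have a0 : (0 < a)%N by rewrite /a; lia.
have ab : (a < b)%N by rewrite /a /b; lia.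
have b0 : (0 < b)%N by lia.
(* No monomial exceeds the weight of (k, l): above height l by maximality of the slope, elsewhere
   because the total degree is at most k + l and a < b. *)
have wf : wdeg a b f = (a * k + b * l)%N.
  apply/eqP; rewrite eqn_leq; apply/andP; split; last first.
    by have := @wdeg_ge _ a b _ _ fkl; rewrite /wt mon0 mon1.
  apply: wdeg_le => m fm; rewrite /wt; have [le _] := inT _ fm.
  case: (ltnP l (m 1%R)) => lm.
    have ms : m \in s by rewrite sE lm.
    have := slope m ms; have := below m ms.
    move: lm le; move: (m 0%R) (m 1%R) => i j lm le lt h.
    have [j' ej] : exists j', j = (l + j')%N by exists (j - l)%N; lia.
    have [k' ek] : exists k', k = (i + k')%N by exists (k - i)%N; lia.
    by move: h; rewrite ej ek !addKn; nia.
  case: (leqP (m 0%R) k) => mk; first by apply: leq_add; rewrite leq_mul2l ?mk ?lm orbT.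
  move: lm le mk; move: (m 0%R) (m 1%R) => i j lm le mk.
  have [j' ej] : exists j', l = (j + j')%N by exists (l - j)%N; lia.
  have [k' ek] : exists k', i = (k + k')%N by exists (i - k)%N; lia.
  by subst l i; nia.
have hF := @whom_wlead _ a b f; have F0 : wlead a b f != 0 by rewrite wlead_eq0.
have FE m : wt a b m = (a * k + b * l)%N -> (wlead a b f)@_m = f@_m.
  by move=> e; rewrite coef_wlead e wf eqxx.
have dE m : wt a b m = (a * k + b * l)%N -> (dehom (wlead a b f))`_(m 1%R) = f@_m.
  by move=> e; rewrite (coef_dehom a0 hF) ?wf // FE.
have wm1 : wt a b m1 = (a * k + b * l)%N.
  rewrite /wt /a /b; move: lm1 bm1 (below _ m1s); move: (m1 0%R) (m1 1%R) => i j lm le mk.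
  have [j' ej] : exists j', j = (l + j')%N by exists (j - l)%N; lia.
  have [k' ek] : exists k', k = (i + k')%N by exists (k - i)%N; lia.
  by subst j k; rewrite !addKn; nia.
clearbody a b; clear slope; set p := dehom (wlead a b f) in dE.
have p0 : p != 0 by apply: contra_neq F0; apply: dehom_inj hF.
have [r er] := closed_field_poly_normal p.
set lc := lead_coef p in er; have lc0 : lc != 0 by rewrite lead_coef_eq0.
have sr : size p = (size r).+1 by rewrite er size_scale // size_prod_XsubC.
have ln : (l < size r)%N.
  have : p`_(m1 1%R) != 0 by rewrite dE.
  by apply: contraR => h; rewrite nth_default // sr; lia.
have [i hi] : exists i, (a * i + b * size r = a * k + b * l)%N.
  have : p`_(size r) != 0 by move: lc0; rewrite /lc lead_coefE sr.
  by case/coef_dehom_neq0=> i /hF; rewrite wf /wt mon0 mon1; exists i.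
have one_root : (size (undup r) <= 1)%N.
  have le_r := size_undup r; have := few_edge_roots char0 a0 b0 tf f0 er; rewrite wf.
  exact: slope_arith hi le_r ln.
have [z ez] := undup1 one_root.
have ep : p = lc *: ('X - z%:P) ^+ size r.
  by rewrite er {1}ez big_nseq -Monoid.iteropE.
have n0 : (0 < size r)%N by lia.
(* For z = 0 only Y^n would occur in F(1, Y), but its coefficient at Y^l is nonzero and l < n. *)
have z0 : z != 0.
  apply/eqP=> z0; have := dE (mon k l); rewrite /wt mon0 mon1 => /(_ erefl).
  rewrite ep z0 subr0 coefZ coefXn ltn_eqF // mulr0 => /eqP.
  by rewrite eq_sym (negPf fkl).
(* As z != 0 and the characteristic is 0, the binomial power has nonzero coefficients in degrees 0
   and 1. So F contains X^i0 and X^i1 Y, and equality of their weights shows that a divides b. *)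
have p_0 : p`_0 != 0.
  rewrite -horner_coef0 ep hornerZ horner_exp hornerXsubC sub0r.
  by rewrite mulf_neq0 // expf_neq0 // oppr_eq0.
have p_1 : p`_1 != 0.
  have := coef_deriv p 0; rewrite mulr1n => <-; rewrite -horner_coef0 ep derivZ deriv_exp derivXsubC.
  rewrite hornerZ hornerMn mul1r horner_exp hornerXsubC sub0r mulf_neq0 // -mulr_natr.
  by rewrite mulf_neq0 // ?natK_eq0 -?lt0n // expf_neq0 // oppr_eq0.
have [i0 fi0 _] := coef_dehom_neq0 p_0; have [i1 fi1 _] := coef_dehom_neq0 p_1.
have := hF _ fi0; have := hF _ fi1; rewrite wf /wt !mon0 !mon1 muln0 addn0 muln1 => e1 e0.
have [t bt] : exists t, b = (a * t)%N.
  by exists (i0 - i1)%N; rewrite mulnBr e0 -e1 addKn.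
have l0 : l = 0%N.
  have : f@_(mon i0 0) != 0 by move: fi0; rewrite FE // /wt mon0 mon1 muln0 addn0.
  by case/inT; rewrite mon0 mon1 addn0 => le _; apply: slope_arith0 ab e0 le.
subst b l; have hX := (whom_shearY a t z).1; have hY := (whom_shearY a t z).2.
have aut := @isAut_shearY _ z t; have inj := isAut_inj aut.
have [e ed eF] := homog_factor a0 hF lc0 er.
rewrite wf !muln0 !addn0 in ed.
exists (shearY z t f); first exact: equivS1_aut.
set g := shearY z t f; have wg : wdeg a (a * t) g = (a * k)%N.
  by rewrite (wdeg_lrmorph hX hY inj) wf muln0 addn0.
have Lg : wlead a (a * t) g = lc *: 'X_[mon e (size r)].
  rewrite (wlead_lrmorph hX hY inj) eF lrmorphZ lrmorphM lrmorphXn subst_lrX.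
  by rewrite {1}ez big_nseq -Monoid.iteropE lrmorphXn shear_factor monX.
have t2 : (1 < t)%N by move: ab; rewrite -{1}(muln1 a) ltn_pmul2l.
have k0 : (0 < k)%N.
  by rewrite -(ltn_pmul2l a0) muln0 -ed addn_gt0 !muln_gt0 a0 n0 (ltnW t2) orbT.
(* The new element g still has weight a k, so only X^k could reach total degree k; it is absent,
   since the leading form of g is a monomial with Y-exponent n > 0. *)
rewrite tdf addn0 -(prednK k0) ltnS; apply: wdeg_le => m gm.
have := @wdeg_ge _ a (a * t) _ _ gm; rewrite wg /wt !mul1n => le.
have [le1 eq1] := slope_arith2 a0 t2 le.
rewrite -ltnS (prednK k0) ltn_neqAle le1 andbT; apply/eqP=> ek; have j0 := eq1 ek.
have := coef_wlead a (a * t) g m; rewrite wg /wt j0 muln0 addn0.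
rewrite j0 addn0 in ek; rewrite ek eqxx Lg mcoeffZ mcoeffX => gE.
case/negP: gm; rewrite -gE; case: (_ =P m) => [em|_]; last by rewrite mulr0.
by move: j0 n0; rewrite -em mon1 => ->.
Qed.

End Reduction.

(** * Existence of a rectangular form, and iterates of ad *)

Section RectangularForm.
Variable K : closedFieldType.
Hypothesis char0 : [pchar K] =i pred0.
Implicit Types (f g F : S1 K) (m : 'X_{1..2}).

Local Notation tdeg := (wdeg 1 1).
Local Notation top := (wlead 1 1).

Lemma mpolyX_neq0 m : 'X_[m] != 0 :> S1 K.
Proof. by apply/eqP=> /(congr1 (mcoeff m)) /eqP; rewrite mcoeffX eqxx mcoeff0 oner_eq0. Qed.

Lemma swap_monomial i j : swap K 'X_[mon i j] = (-1) ^+ j *: 'X_[mon j i].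
Proof.
rewrite !monX lrmorphM !lrmorphXn subst_lrX subst_lrY -scaleN1r exprZn -scalerAr.
by congr (_ *: _); exact: mulrC.
Qed.

Lemma coef_swap f i j : (swap K f)@_(mon j i) = (-1) ^+ j * f@_(mon i j).
Proof.
elim/mpolyind: f => [|c m f _ _ IH]; first by rewrite rmorph0 !mcoeff0 mulr0.
rewrite lrmorphD lrmorphZ (monE m) swap_monomial mcoeffD IH mcoeffD !mcoeffZ !mcoeffX mulrDr.
congr (_ + _).
have -> : (mon (m 1%R) (m 0%R) == mon j i) = (mon (m 0%R) (m 1%R) == mon i j).
  apply/eqP/eqP=> e; have := congr1 (fun m : 'X_{1..2} => m (0 : 'I_2)) e;
    have := congr1 (fun m : 'X_{1..2} => m (1 : 'I_2)) e;
    by rewrite /= !mon0 !mon1 => -> ->.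
case: eqP => [/(congr1 (fun m : 'X_{1..2} => m (1 : 'I_2)))|]; last by rewrite !mulr0.
by rewrite /= !mon1 => ->; rewrite !mulr1 mulrC.
Qed.

Lemma whom_swap : whom 1 1 1 (swap K varX) /\ whom 1 1 1 (swap K varY).
Proof.
rewrite subst_lrX subst_lrY; split; first exact: whom_varY.
by rewrite -scaleN1r; apply: whomZ; exact: whom_varX.
Qed.

Lemma tdeg_swap f : tdeg (swap K f) = tdeg f.
Proof.
rewrite (wdeg_lrmorph (proj1 whom_swap) (proj2 whom_swap)) //.
by apply: isAut_inj; exact: isAut_swap.
Qed.

Lemma top_swap f : top (swap K f) = swap K (top f).
Proof.
rewrite (wlead_lrmorph (proj1 whom_swap) (proj2 whom_swap)) //.
by apply: isAut_inj; exact: isAut_swap.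
Qed.

Lemma rectS1_swap k n f : rectS1 k n f -> rectS1 n k (swap K f).
Proof.
have sgn l : ((-1) ^+ l : K) != 0 by rewrite signr_eq0.
case=> fkn f0; split; first by rewrite (coef_swap f k n) mulf_neq0.
by move=> i j h; rewrite (coef_swap f j i) f0 ?mulr0 // or_comm.
Qed.

(** Induction on a bound for the total degree. A monomial above the corner (k, l), or to its right
    after [swap], allows a reduction; otherwise the element is rectangular. *)
Lemma exists_rect f : tame f -> exists g k n,
  [/\ equivS1 f g, rectS1 k n g, (n <= k)%N & (0 < k)%N].
Proof.
have [N lt] : exists N, (tdeg f < N)%N by exists (tdeg f).+1.
elim: N f lt => // N IH f lt tf.
have red h g : equivS1 f h -> equivS1 h g -> (tdeg g < tdeg f)%N -> exists g k n,
  [/\ equivS1 f g, rectS1 k n g, (n <= k)%N & (0 < k)%N].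
  move=> e1 e2 ltg; have e3 := equivS1_trans e1 e2.
  have [|g' [k [n [e4 r1 r2 r3]]]] := IH g (leq_trans ltg lt); first exact: tame_equiv tf.
  by exists g', k, n; split=> //; apply: equivS1_trans e4.
have [h [c [k [l [eh dh c0 toph]]]]] := monomial_top char0 tf.
have th := tame_equiv eh tf.
case: (boolP (has (fun m : 'X_{1..2} => l < m 1%R)%N (msupp h))) => [/hasP [m mh lm]|/hasPn hl].
  rewrite mcoeff_msupp in mh; have [g eg] := tdeg_reduction char0 th toph c0 mh lm.
  by rewrite dh; apply: red eg.
have es : equivS1 h (swap K h) by apply: equivS1_aut; exact: isAut_swap.
have fs := equivS1_trans eh es.
case: (boolP (has (fun m : 'X_{1..2} => k < m 0%R)%N (msupp h))) => [/hasP [m mh lm]|/hasPn hk].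
  have tops : top (swap K h) = (c * (-1) ^+ l) *: 'X_[mon l k].
    by rewrite top_swap toph lrmorphZ swap_monomial scalerA.
  have c0' : c * (-1) ^+ l != 0 by rewrite mulf_neq0 // signr_eq0.
  have hs : (swap K h)@_(mon (m 1%R) (m 0%R)) != 0.
    by rewrite coef_swap -monE mulf_neq0 ?signr_eq0 // -mcoeff_msupp.
  have [|g eg] := tdeg_reduction char0 (tame_equiv es th) tops c0' hs; first by rewrite mon1.
  by rewrite tdeg_swap dh; apply: red fs eg.
have rh : rectS1 k l h.
  split=> [|i j]; first exact: coef_monomial_top_neq0 toph c0.
  case=> lt'; apply/eqP; rewrite mcoeff_eq0; apply/negP=> inh.
    by have := hk _ inh; rewrite mon0 lt'.
  by have := hl _ inh; rewrite mon1 lt'.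
have kl0 : (0 < k + l)%N.
  rewrite -(tdeg_monomial_top toph c0); have [g] := tame_bracket th.
  exact: wdeg_gt0.
case: (leqP l k) => lk.
  by exists h, k, l; split=> //; lia.
exists (swap K h), l, k; split=> //; [exact: rectS1_swap | exact: ltnW | lia].
Qed.

Lemma rect_top k n f : rectS1 k n f -> top f = f@_(mon k n) *: 'X_[mon k n].
Proof.
case=> fkn f0; have le m : f@_m != 0 -> (m 0%R <= k)%N && (m 1%R <= n)%N.
  rewrite (monE m) mon0 mon1; apply: contraR; rewrite negb_and -!ltnNge => /orP h.
  by apply/eqP/f0.
have wf : tdeg f = (k + n)%N.
  apply/eqP; rewrite eqn_leq; apply/andP; split.
    by apply: wdeg_le => m /le /andP [h1 h2]; rewrite /wt !mul1n leq_add.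
  by have := @wdeg_ge _ 1 1 _ _ fkn; rewrite /wt !mul1n mon0 mon1.
apply/mpolyP=> m; rewrite coef_wlead wf mcoeffZ mcoeffX /wt !mul1n.
case: (_ =P m) => [<-|ne]; first by rewrite mon0 mon1 eqxx mulr1.
rewrite mulr0; case: eqP => // e; apply/eqP; apply: contraT => /le /andP [h1 h2].
by case: ne; rewrite (monE m); congr mon; lia.
Qed.

Lemma bracket_monomial p q i j : bracket 'X_[mon p.+1 q.+1] 'X_[mon i j] =
  ((p.+1 * j)%:R - (q.+1 * i)%:R) *: 'X_[mon (p + i) (q + j)] :> S1 K.
Proof.
have d0 u v : mderiv 0 'X_[mon u v] = u%:R *: 'X_[mon u.-1 v] :> S1 K.
  rewrite mderivX mon0; congr (_ *: 'X_[_]); apply/mnmP=> l; rewrite mnmBE U0E.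
  by case: (ord2P l) => ->; rewrite ?mon0 ?mon1; lia.
have d1 u v : mderiv 1 'X_[mon u v] = v%:R *: 'X_[mon u v.-1] :> S1 K.
  rewrite mderivX mon1; congr (_ *: 'X_[_]); apply/mnmP=> l; rewrite mnmBE U1E.
  by case: (ord2P l) => ->; rewrite ?mon0 ?mon1; lia.
rewrite /bracket !d0 !d1 -!scalerAl -!scalerAr -!mpolyXD !monD !scalerA scalerBl !natrM /=.
congr (_ - _).
  by case: j => [|j]; rewrite ?mulr0 ?scale0r //= addSnnS addnS.
by case: i => [|i]; rewrite ?mulr0 ?scale0r //= addSnnS addnS.
Qed.

Lemma bracket_monomial_neq0 p q i j : (p.+1 * j != q.+1 * i)%N ->
  bracket 'X_[mon p.+1 q.+1] 'X_[mon i j] != 0 :> S1 K.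
Proof.
move=> ne; rewrite bracket_monomial scaler_eq0 negb_or; apply/andP; split; last exact: mpolyX_neq0.
by rewrite subr_eq0; apply: contra_neq ne => /(natK_inj char0).
Qed.

(** As long as the exponent vectors of the leading monomials are not proportional, the leading forms
    do not commute and each step adds (p, q). The sequences i and j are abstract so that X and Y can
    both serve as starting points. *)
Lemma ad_growth f c p q (h : S1 K) (i j : nat -> nat) :
  top f = c *: 'X_[mon p.+1 q.+1] -> c != 0 -> top h = 'X_[mon (i 0) (j 0)] ->
  (forall N, i N.+1 = p + i N)%N -> (forall N, j N.+1 = q + j N)%N ->
  (forall N, p.+1 * j N != q.+1 * i N)%N ->
  forall N, exists2 d, d != 0 & top (iter N (ad f) h) = d *: 'X_[mon (i N) (j N)].
Proof.
move=> tf c0 th iS jS ne; elim=> [|N [d d0 eN]]; first by exists 1; rewrite ?oner_neq0 ?scale1r.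
have LE : bracket (top f) (top (iter N (ad f) h)) =
    (c * d) *: bracket 'X_[mon p.+1 q.+1] 'X_[mon (i N) (j N)].
  by rewrite tf eN bracketZr bracket_antisym bracketZr -scalerN -bracket_antisym !scalerA mulrC.
have L0 : bracket (top f) (top (iter N (ad f) h)) != 0.
  by rewrite LE scaler_eq0 negb_or mulf_neq0 //= bracket_monomial_neq0.
exists (c * d * ((p.+1 * j N)%:R - (q.+1 * i N)%:R)).
  rewrite !mulf_neq0 // subr_eq0; apply: contraTneq (ne N) => /(natK_inj char0) ->.
  by rewrite eqxx.
rewrite iterS {1}/ad; have [-> _] := wlead_bracket L0.
by rewrite LE bracket_monomial scalerA iS jS.
Qed.

(** Starting from X if q <= p, and from Y otherwise, keeps the determinant of the two exponent
    vectors nonzero at every step. *)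
Lemma ad_unbounded f c p q : top f = c *: 'X_[mon p.+1 q.+1] -> c != 0 ->
  exists h, forall N, iter N (ad f) h != 0 /\ tdeg (iter N (ad f) h) = (N * (p + q)).+1.
Proof.
move=> tf c0; have wrap (h : S1 K) i j : (i 0 + j 0 = 1)%N -> top h = 'X_[mon (i 0%N) (j 0%N)] ->
  (forall N, i N.+1 = p + i N)%N -> (forall N, j N.+1 = q + j N)%N ->
  (forall N, p.+1 * j N != q.+1 * i N)%N ->
  forall N, iter N (ad f) h != 0 /\ tdeg (iter N (ad f) h) = (N * (p + q)).+1.
  move=> ij0 th iS jS ne N; have [d d0 eN] := ad_growth tf c0 th iS jS ne N.
  split; first by rewrite -(wlead_eq0 1 1) eN scaler_eq0 negb_or d0 mpolyX_neq0.
  rewrite (tdeg_monomial_top eN d0); elim: N {eN} => [|N IH]; first by rewrite ij0.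
  by rewrite iS jS addnACA IH mulSn addnS.
case: (leqP q p) => pq.
  exists varX; apply: (wrap varX (fun N => N * p + 1)%N (fun N => N * q)%N) => //.
  - by rewrite (whom_lead (whom_varX _ _)) /varX U0E.
  - by move=> N; rewrite mulSn addnA.
  - by move=> N; rewrite ltn_eqF //; have := leq_mul (leqnn N) pq; nia.
exists varY; apply: (wrap varY (fun N => N * p)%N (fun N => N * q + 1)%N) => //.
- by rewrite (whom_lead (whom_varY _ _)) /varY U1E.
- by move=> N; rewrite mulSn addnA.
- by move=> N; rewrite gtn_eqF //; have := leq_mul (leqnn N) (ltnW pq); nia.
Qed.

Lemma locally_nilpotent_varX g : exists N, iter N (ad (varX : S1 K)) g = 0.
Proof.
have [N hN] : exists N, forall m, g@_m != 0 -> (m 1%R < N)%N.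
  (* With weights (0, 1) the weighted degree is the degree in Y, which ad_X = d/dY lowers. *)
  by exists (wdeg 0 1 g).+1 => m /(@wdeg_ge _ 0 1); rewrite /wt mul0n mul1n.
exists N; elim: N g hN => [|N IH] g hN.
  by apply/mpolyP=> m; rewrite mcoeff0; apply/eqP; apply: contraT => /hN.
rewrite iterSr; apply: IH => m; rewrite /ad bracket_antisym bracketXr opprK mcoeff_deriv => h.
have /hN : g@_(m + U_(1%R : 'I_2)) != 0 by apply: contraNneq h => ->; rewrite mul0rn.
by rewrite mnmDE mnm1E eqxx addn1.
Qed.

Lemma iter_ad_aut (phi : {lrmorphism S1 K -> S1 K}) f g N : isAut phi ->
  iter N (ad (phi f)) (phi g) = phi (iter N (ad f) g).
Proof. by case=> _ br; elim: N => //= N ->; rewrite /ad br. Qed.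

Lemma locally_nilpotent_aut (phi : {lrmorphism S1 K -> S1 K}) g : isAut phi ->
  exists N, iter N (ad (phi varX)) g = 0.
Proof.
move=> aut; have [psi [_ _ K2]] := isAut_inv aut; have [N hN] := locally_nilpotent_varX (psi g).
by exists N; rewrite -[g]K2 iter_ad_aut // hN rmorph0.
Qed.

End RectangularForm.

(** * Leading forms of the images of X and Y *)

Section Uniqueness.
Variable K : closedFieldType.
Hypothesis char0 : [pchar K] =i pred0.
Implicit Types (f g F P Q : S1 K) (m : 'X_{1..2}) (phi : {lrmorphism S1 K -> S1 K}).

Local Notation tdeg := (wdeg 1 1).
Local Notation top := (wlead 1 1).

Lemma size_Phi_leq f N : (tdeg f < N)%N -> (size (Phi 1 1 f) <= N)%N.
Proof. by apply: leq_trans; exact: leqSpred. Qed.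

Lemma lrmorph_monomial phi m : phi 'X_[m] = phi varX ^+ m 0%R * phi varY ^+ m 1%R.
Proof. by rewrite {1}(monE m) monX lrmorphM !lrmorphXn. Qed.

Lemma size_Phi_lrmorph phi f N : (forall m, f@_m != 0 ->
    (tdeg (phi varX) * m 0%R + tdeg (phi varY) * m 1%R < N)%N) ->
  phi varX != 0 -> phi varY != 0 -> (size (Phi 1 1 (phi f)) <= N)%N.
Proof.
move=> h P0 Q0; rewrite [f]mpolyE (raddf_sum phi) raddf_sum.
apply: (leq_trans (size_sum _ _ _)); apply/bigmax_leqP_seq => m mf _.
rewrite mcoeff_msupp in mf; rewrite /= lrmorphZ lrmorph_monomial.
apply: size_Phi_leq; rewrite wdegZ // wdegM ?expf_neq0 // !wdegX //.
by have := h m mf; rewrite mulnC (mulnC (tdeg (phi varY))).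
Qed.

(** The images of X and Y have positive degree, so every monomial of f other than X^k Y^n has an
    image of strictly smaller degree and cannot cancel the top form. *)
Lemma rect_top_aut phi k n f : isAut phi -> rectS1 k n f ->
  top (phi f) = f@_(mon k n) *: (top (phi varX) ^+ k * top (phi varY) ^+ n).
Proof.
move=> aut [fkn f0]; have PQ : bracket (phi varX) (phi varY) != 0.
  by rewrite isAut_bracketXY // oner_neq0.
have p0 : (0 < tdeg (phi varX))%N by apply: wdeg_gt0 PQ.
have q0 : (0 < tdeg (phi varY))%N.
  by apply: (@wdeg_gt0 _ 1 1 isT isT _ (phi varX)); rewrite bracket_antisym oppr_eq0.
have P0 : phi varX != 0 by apply: contraNneq PQ => ->; rewrite bracket_antisym bracket0r oppr0.
have Q0 : phi varY != 0 by apply: contraNneq PQ => ->; rewrite bracket0r.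
set c := f@_(mon k n); pose h := f - c *: 'X_[mon k n].
have ef : f = c *: 'X_[mon k n] + h by rewrite addrC subrK.
have topA : top (phi (c *: 'X_[mon k n])) = c *: (top (phi varX) ^+ k * top (phi varY) ^+ n).
  by rewrite lrmorphZ wleadZ monX lrmorphM !lrmorphXn wleadM !wleadX.
have A0 : phi (c *: 'X_[mon k n]) != 0.
  by rewrite isAut_eq0 // scaler_eq0 negb_or fkn mpolyX_neq0.
have wA : tdeg (phi (c *: 'X_[mon k n])) = (k * tdeg (phi varX) + n * tdeg (phi varY))%N.
  by rewrite lrmorphZ wdegZ // monX lrmorphM !lrmorphXn wdegM ?expf_neq0 // !wdegX.
rewrite -topA {1}ef lrmorphD /wlead rmorphD lead_coefDl //.
apply: (@leq_ltn_trans (tdeg (phi (c *: 'X_[mon k n])))); last first.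
  by rewrite /wdeg ltn_predL size_Phi_gt0.
apply: size_Phi_lrmorph => // m; rewrite mcoeffB mcoeffZ mcoeffX wA.
case: (_ =P m) => [<-|ne]; first by rewrite mulr1 subrr eqxx.
rewrite mulr0 subr0 => fm.
have lek : (m 0%R <= k)%N.
  by rewrite leqNgt; apply: contraNN fm => lt; rewrite (monE m) f0 //; left.
have len : (m 1%R <= n)%N.
  by rewrite leqNgt; apply: contraNN fm => lt; rewrite (monE m) f0 //; right.
rewrite mulnC (mulnC (tdeg (phi varY))).
have le1 := leq_mul lek (leqnn (tdeg (phi varX))); have le2 := leq_mul len (leqnn (tdeg (phi varY))).
rewrite ltn_neqAle leq_add // andbT; apply/eqP=> e.
have e1 : (m 0%R * tdeg (phi varX) = k * tdeg (phi varX))%N by lia.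
have e2 : (m 1%R * tdeg (phi varY) = n * tdeg (phi varY))%N by lia.
case: ne; rewrite (monE m); congr mon; first by apply/eqP; rewrite -(eqn_pmul2r p0) e1.
by apply/eqP; rewrite -(eqn_pmul2r q0) e2.
Qed.

(** At X = 1 the form F divides a multiple of Y^n, hence is a multiple of a power of Y, and
    [homog_factor] restores the power of X. *)
Lemma monomial_divisor d e F G (c : K) k n : whom 1 1 d F -> whom 1 1 e G -> c != 0 ->
  F * G = c *: 'X_[mon k n] -> exists c' i j, c' != 0 /\ F = c' *: 'X_[mon i j].
Proof.
move=> hF hG c0 eFG; have FG0 : F * G != 0 by rewrite eFG scaler_eq0 negb_or c0 mpolyX_neq0.
have F0 : F != 0 by apply: contraNneq FG0 => ->; rewrite mul0r.
have p0 : dehom F != 0 by apply: contra_neq F0; apply: dehom_inj hF.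
have dv : dehom F %| ('X - 0%:P) ^+ n.
  apply: (@dvdp_trans _ (dehom F * dehom G)); first exact: dvdp_mulr.
  have -> : dehom F * dehom G = c *: ('X - 0%:P) ^+ n.
    rewrite -rmorphM eFG -mul_mpolyC rmorphM monX rmorphM !rmorphXn /= dehomC dehomX dehomY.
    by rewrite expr1n mul1r mul_polyC subr0.
  by rewrite dvdpZl.
have [j _ /eqpf_eq [c' c'0 ec]] := dvdp_exp_XsubCP dv.
have [|i _ eF] := @homog_factor _ 1 1 d F c' (nseq j 0) isT hF c'0.
  by rewrite ec big_nseq -Monoid.iteropE.
exists c', i, j; split=> //; rewrite eF big_nseq -Monoid.iteropE scale0r subr0 monX //.
Qed.

Lemma monomial_inj (c c' : K) i j i' j' : c != 0 ->
  c *: 'X_[mon i j] = c' *: 'X_[mon i' j'] :> S1 K -> [/\ c = c', i = i' & j = j'].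
Proof.
move=> c0 /(congr1 (mcoeff (mon i j))); rewrite !mcoeffZ !mcoeffX eqxx mulr1.
case: (_ =P mon i j) => [e|_]; last by rewrite mulr0 => e; rewrite e eqxx in c0.
rewrite mulr1 => ->; split=> //.
  by have := congr1 (fun m : 'X_{1..2} => m (0 : 'I_2)) e; rewrite /= !mon0.
by have := congr1 (fun m : 'X_{1..2} => m (1 : 'I_2)) e; rewrite /= !mon1.
Qed.

(** A mixed monomial would contradict the local nilpotency of ad_(phi X), by [ad_unbounded]. *)
Lemma aut_monomial_pure phi c i j : isAut phi -> top (phi varX) = c *: 'X_[mon i j] ->
  c != 0 -> (i = 0%N /\ (0 < j)%N) \/ (j = 0%N /\ (0 < i)%N).
Proof.
move=> aut tP c0; have PQ : bracket (phi varX) (phi varY) != 0.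
  by rewrite isAut_bracketXY // oner_neq0.
have := @wdeg_gt0 _ 1 1 isT isT _ _ PQ; rewrite (tdeg_monomial_top tP c0).
case: i tP => [|i] tP; first by left.
case: j tP => [|j] tP; first by right.
have [h hN] := ad_unbounded char0 tP c0; have [N eN] := locally_nilpotent_aut h aut.
by have [] := hN N; rewrite eN eqxx.
Qed.

Lemma aut_swap_monomial_pure phi c i j : isAut phi -> top (phi varY) = c *: 'X_[mon i j] ->
  c != 0 -> (i = 0%N /\ (0 < j)%N) \/ (j = 0%N /\ (0 < i)%N).
Proof.
move=> aut tQ; apply: (aut_monomial_pure (isAut_comp aut (isAut_swap K))).
by rewrite -tQ /= comp_mpolyXU.
Qed.

Lemma degree_one P c : tdeg P = 1%N -> top P = c *: varX ->
  exists d, P = c *: varX + d%:MP.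
Proof.
move=> w1 tP; exists P@_0%MM; apply/mpolyP=> m; have := coef_wlead 1 1 P m.
have le := @wdeg_ge _ 1 1 P m; rewrite w1 tP mcoeffD mcoeffC mcoeffZ /wt !mul1n in le *.
case: (ltngtP (m 0%R + m 1%R) 1) => [lt|gt|e] ce.
- have -> : m = 0%MM.
    by apply/mnmP=> l; rewrite mnm0E; case: (ord2P l) => ->; lia.
  by rewrite eqxx mulr1 mcoeffX U0E; case: eqP => [|_]; rewrite ?mulr0 ?add0r // => /(congr1 (fun m : 'X_{1..2} => m (0 : 'I_2))); rewrite /= mon0 mnm0E.
- rewrite ce; case: (m =P 0%MM) => [em|_]; first by rewrite em !mnm0E in gt.
  rewrite mulr0 addr0; apply/eqP; by apply: contraTT gt => h; rewrite -leqNgt le.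
- rewrite ce; case: (m =P 0%MM) => [em|_]; first by rewrite em !mnm0E in e.
  by rewrite mulr0 addr0.
Qed.

End Uniqueness.

(** * Automorphisms between rectangular elements *)

Section RectangularAutomorphisms.
Variable K : closedFieldType.
Hypothesis char0 : [pchar K] =i pred0.
Implicit Types (f g F P Q : S1 K) (m : 'X_{1..2}) (phi : {lrmorphism S1 K -> S1 K}).

Local Notation tdeg := (wdeg 1 1).
Local Notation top := (wlead 1 1).

Lemma bracket_pure (c d : K) i j : c != 0 -> d != 0 -> (0 < i)%N -> (0 < j)%N ->
  bracket (c *: 'X_[mon i 0]) (d *: 'X_[mon 0 j]) != 0 :> S1 K.
Proof.
move=> c0 d0; case: i j => [|i] [|j] // _ _.
rewrite bracketZr bracket_antisym bracketZr -scalerN -bracket_antisym.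
have -> : bracket 'X_[mon i.+1 0] 'X_[mon 0 j.+1] =
    (i.+1%:R * j.+1%:R) *: 'X_[mon i j] :> S1 K.
  rewrite !monX expr0 mulr1 mul1r bracketXnr bracketYr mderivXn mderivX0 mulr1.
  by rewrite -mulrnAr -mulrnA -scaler_nat -scalerAr natrM [X in X *: _]mulrC; congr (_ *: _); exact: mulrC.
by rewrite !scaler_eq0 !negb_or mulf_neq0 ?natK_eq0 // d0 c0 mpolyX_neq0.
Qed.

Lemma tdeg_bracket_top P Q : bracket P Q = 1 -> bracket (top P) (top Q) != 0 ->
  (tdeg P + tdeg Q = 2)%N.
Proof.
by move=> e /wlead_bracket [_ <-]; rewrite e -mpolyC1 wdegC.
Qed.

Lemma diagonal_aut phi c d : isAut phi -> top (phi varX) = c *: varX -> top (phi varY) = d *: varY ->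
  c != 0 -> d != 0 -> exists c1 c2,
  [/\ phi varX = c *: varX + c1%:MP, phi varY = d *: varY + c2%:MP & c * d = 1].
Proof.
move=> aut tP tQ c0 d0; have PQ := isAut_bracketXY aut.
have wP : tdeg (phi varX) = 1%N by rewrite (@tdeg_monomial_top _ _ c 1 0) // tP /varX U0E.
have wQ : tdeg (phi varY) = 1%N by rewrite (@tdeg_monomial_top _ _ d 0 1) // tQ /varY U1E.
have [c1 e1] := degree_one wP tP.
have [c2 e2] : exists c2, phi varY = d *: varY + c2%:MP.
  have wS : tdeg (swap K (phi varY)) = 1%N by rewrite tdeg_swap.
  have tS : top (swap K (phi varY)) = (- d) *: varX.
    by rewrite top_swap tQ lrmorphZ subst_lrY scalerN scaleNr.
  have [c2 e2] := degree_one wS tS; exists c2.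
  apply: (isAut_inj (isAut_swap K)); rewrite e2 lrmorphD lrmorphZ subst_lrY lrmorphC.
  by rewrite scalerN scaleNr.
exists c1, c2; split=> //; move: PQ; rewrite e1 e2 bracketDr bracketC addr0 bracketZr.
rewrite bracket_antisym bracketDr bracketC addr0 bracketZr -scalerN -bracket_antisym bracketXY.
rewrite scalerA => /(congr1 (mcoeff 0%MM)).
by rewrite mcoeffZ mcoeff1 eqxx mulr1 mulrC.
Qed.

(** The two leading forms divide a monomial, so they are pure powers, of different variables since
    k' and n' are positive. They do not commute, so both have degree 1. The antidiagonal case
    exchanges k and n, which the orderings allow only for k = n. *)
Lemma rect_aut_pos phi k n k' n' f : isAut phi -> rectS1 k n f -> rectS1 k' n' (phi f) ->
  (n <= k)%N -> (n' <= k')%N -> (0 < n)%N -> (0 < n')%N ->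
  [/\ k' = k, n' = n & (n < k)%N -> exists a1 a2 c1 c2,
     [/\ phi varX = a1 *: varX + c1%:MP, phi varY = a2 *: varY + c2%:MP & a1 * a2 = 1]].
Proof.
move=> aut r1 r2 nk nk' n0 n0'; have [fkn _] := r1; have [fkn' _] := r2.
have k0 : (0 < k)%N by apply: leq_trans nk. have k0' : (0 < k')%N by apply: leq_trans nk'.
have PQ := isAut_bracketXY aut.
set c := f@_(mon k n); set c' := (phi f)@_(mon k' n').
have c0 : c != 0 by []. have c0' : c' != 0 by [].
have E : top (phi varX) ^+ k * top (phi varY) ^+ n = (c^-1 * c') *: 'X_[mon k' n'].
  apply: (@scalerI _ _ c); first exact: c0.
  by rewrite scalerA mulrA mulfV // mul1r -rect_top // -rect_top_aut.
have cc0 : c^-1 * c' != 0 by rewrite mulf_neq0 // invr_eq0.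
have hP := @whom_wlead _ 1 1 (phi varX); have hQ := @whom_wlead _ 1 1 (phi varY).
have [al [i [j [al0 tP]]]] : exists al i j, al != 0 /\ top (phi varX) = al *: 'X_[mon i j].
  apply: (monomial_divisor hP (whomM (whomX (n := k.-1) hP) (whomX (n := n) hQ)) cc0).
  by rewrite mulrA -exprS prednK // E.
have [be [u [v [be0 tQ]]]] : exists be u v, be != 0 /\ top (phi varY) = be *: 'X_[mon u v].
  apply: (monomial_divisor hQ (whomM (whomX (n := k) hP) (whomX (n := n.-1) hQ)) cc0).
  by rewrite mulrCA -exprS prednK // E.
have : (al ^+ k * be ^+ n) *: 'X_[mon (i * k + u * n) (j * k + v * n)] = (c^-1 * c') *: 'X_[mon k' n'] :> S1 K.
  rewrite -E tP tQ !exprZn -scalerAl -scalerAr scalerA; congr (_ *: _).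
  by rewrite !monX !exprMn -!exprM !exprD; ring.
case/monomial_inj; first by rewrite mulf_neq0 // expf_neq0.
move=> _ ek en.
have degP := tdeg_monomial_top tP al0; have degQ := tdeg_monomial_top tQ be0.
case: (aut_monomial_pure char0 aut tP al0) (aut_swap_monomial_pure char0 aut tQ be0);
  move=> [z1 p1] [] [z2 p2]; subst.
- by move: k0'; rewrite !mul0n.
- have B : bracket (top (phi varX)) (top (phi varY)) != 0.
    by rewrite tP tQ bracket_antisym oppr_eq0 bracket_pure.
  have := tdeg_bracket_top PQ B; rewrite degP degQ => e2.
  have [ej eu] : j = 1%N /\ u = 1%N by lia.
  by split=> //; lia.
- have B : bracket (top (phi varX)) (top (phi varY)) != 0 by rewrite tP tQ bracket_pure.
  have := tdeg_bracket_top PQ B; rewrite degP degQ => e2.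
  have [ei ev] : i = 1%N /\ v = 1%N by lia.
  subst i v; split; [lia | lia | move=> _].
  have [||c1 [c2 [h1 h2 h3]]] := diagonal_aut aut _ _ al0 be0; first by rewrite tP /varX U0E.
    by rewrite tQ /varY U1E.
  by exists al, be, c1, c2.
by move: n0'; rewrite !mul0n.
Qed.

Lemma rect_n0_deriv k f : rectS1 k 0 f -> mderiv 1 f = 0.
Proof.
case=> _ f0; apply/mpolyP=> m; rewrite mcoeff_deriv mcoeff0 (monE m) U1E monD f0 ?mul0rn //.
by right; rewrite addn1.
Qed.

Lemma lrmorph_eq_n0 phi (psi : {lrmorphism S1 K -> S1 K}) k f : rectS1 k 0 f -> phi varX = psi varX -> phi f = psi f.
Proof.
case=> _ f0 e; rewrite (mpolyE f) (raddf_sum phi) (raddf_sum psi); apply: eq_big_seq => m.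
rewrite mcoeff_msupp => fm; rewrite /= !lrmorphZ (lrmorph_monomial phi m) (lrmorph_monomial psi m).
have -> : m 1%R = 0%N.
  by apply/eqP; apply: contraNT fm => m1; rewrite (monE m) f0 //; right; rewrite lt0n.
by rewrite e !expr0.
Qed.

(** Here f lies in K[X], so phi matters only through phi X, and a [scaling] with the same value at X
    can replace it. The ordering n' <= k' rules out a power of Y as leading form of phi X. *)
Lemma rect_aut_zero phi k k' n' f : isAut phi -> rectS1 k 0 f -> rectS1 k' n' (phi f) ->
  (n' <= k')%N -> (0 < k)%N ->
  [/\ k' = k, n' = 0%N & exists a c, a != 0 /\ phi f = scaling a c f].
Proof.
move=> aut r1 r2 nk' k0; have [fkn _] := r1; have [fkn' _] := r2.
have PQ := isAut_bracketXY aut.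
set c := f@_(mon k 0); set c' := (phi f)@_(mon k' n').
have c0 : c != 0 by []. have c0' : c' != 0 by [].
have E : top (phi varX) ^+ k = (c^-1 * c') *: 'X_[mon k' n'].
  apply: (@scalerI _ _ c); first exact: c0.
  rewrite scalerA mulrA mulfV // mul1r -rect_top // (rect_top_aut aut r1).
  by rewrite expr0 mulr1.
have cc0 : c^-1 * c' != 0 by rewrite mulf_neq0 // invr_eq0.
have hP := @whom_wlead _ 1 1 (phi varX).
have [al [i [j [al0 tP]]]] : exists al i j, al != 0 /\ top (phi varX) = al *: 'X_[mon i j].
  apply: (monomial_divisor hP (whomX (n := k.-1) hP) cc0).
  by rewrite -exprS prednK // E.
have : (al ^+ k) *: 'X_[mon (i * k) (j * k)] = (c^-1 * c') *: 'X_[mon k' n'] :> S1 K.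
  rewrite -E tP !exprZn; congr (_ *: _).
  by rewrite !monX !exprMn -!exprM.
case/monomial_inj; first by rewrite expf_neq0.
move=> _ ek en; have degP := tdeg_monomial_top tP al0.
case: (aut_monomial_pure char0 aut tP al0) => [] [z1 p1].
  by move: nk'; rewrite -ek -en z1 mul0n leqn0 muln_eq0; lia.
have n'0 : n' = 0%N by rewrite -en z1.
(* By the chain rule phi(df/dX) times this derivative is the Y-derivative of phi f, which is zero,
   and df/dX is nonzero. *)
have P1 : mderiv 1 (phi varX) = 0.
  have := chain_rule phi 1 f; rewrite n'0 in r2.
  rewrite (rect_n0_deriv r2) (rect_n0_deriv r1) rmorph0 mul0r addr0.
  move/esym/eqP; rewrite mulf_eq0 isAut_eq0 // => /orP [/eqP d0|/eqP //].
  have f_const := mderiv_eq0 char0 d0 (rect_n0_deriv r1).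
  case/negP: fkn; rewrite f_const mcoeffC -/(mon k 0); case: (mon k 0 =P 0%MM) => [|_]; last by rewrite mulr0.
  by move/(congr1 (fun m : 'X_{1..2} => m (0 : 'I_2))); rewrite /= mon0 mnm0E; lia.
(* The Jacobian has become a product equal to 1, so its factors are constants and phi X is affine in
   X. *)
have dd : mderiv 0 (phi varX) * mderiv 1 (phi varY) = 1.
  by rewrite -PQ /bracket P1 mul0r subr0.
have [d1 d2] : mderiv 0 (phi varX) != 0 /\ mderiv 1 (phi varY) != 0.
  by apply/andP; rewrite -negb_or -mulf_eq0 dd oner_neq0.
have w0 : wdeg 1 1 (mderiv 0 (phi varX)) = 0%N.
  by have := wdegM 1 1 d1 d2; rewrite dd -mpolyC1 wdegC; lia.
have dC := @wdeg0_const _ 1 1 isT isT _ w0; set a := _@_0%MM in dC.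
have a0 : a != 0 by apply: contraNneq d1 => a0; rewrite dC a0 mpolyC0.
have eP : phi varX - a *: varX = ((phi varX - a *: varX)@_0%MM)%:MP.
  apply: mderiv_eq0 => //; rewrite mderivB mderivZ.
    by rewrite dC mderivX0 -mul_mpolyC mulr1 subrr.
  by rewrite P1 mderivX1 scaler0 subrr.
set d := (phi varX - a *: varX)@_0%MM in eP.
have {}eP : phi varX = a *: varX + d%:MP by rewrite -eP addrC subrK.
have i1 : i = 1%N.
  have le : (tdeg (phi varX) <= 1)%N.
    apply: wdeg_le => m; rewrite eP mcoeffD mcoeffZ mcoeffC /varX U0E mcoeffX /wt !mul1n.
    case: (_ =P m) => [<-|_]; first by rewrite mon0 mon1.
    by case: (m =P _) => [->|_]; rewrite ?mnm0E // !mulr0 addr0 eqxx.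
  by move: le; rewrite degP z1; lia.
split=> //; first by rewrite -ek i1 mul1n.
exists a, d; split=> //; apply: lrmorph_eq_n0 r1 _.
by rewrite subst_lrX eP.
Qed.

Lemma rect_aut phi k n k' n' f : isAut phi -> rectS1 k n f -> rectS1 k' n' (phi f) ->
  (n <= k)%N -> (n' <= k')%N -> (0 < k)%N -> (0 < k')%N ->
  [/\ k' = k, n' = n & (n < k)%N -> exists psi a1 a2 c1 c2,
     [/\ isAut psi, psi varX = a1 *: varX + c1%:MP, psi varY = a2 *: varY + c2%:MP,
         a1 * a2 = 1 & phi f = psi f]].
Proof.
move=> aut r1 r2 nk nk' k0 k0'; case: (posnP n) => [n0|n0].
  subst n; have [-> -> [a [c [a0 e]]]] := rect_aut_zero aut r1 r2 nk' k0.
  split=> // _; exists (scaling a c), a, a^-1, c, 0; split=> //.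
  - exact: isAut_scaling.
  - by rewrite subst_lrX.
  - by rewrite subst_lrY mpolyC0 addr0.
  - by rewrite mulfV.
case: (posnP n') => [n0'|n0'].
  (* For n' = 0 < n the previous case applies to the inverse automorphism and yields n = 0, a
     contradiction. *)
  subst n'; have [psi [aut' K1 _]] := isAut_inv aut.
  have r3 : rectS1 k n (psi (phi f)) by rewrite K1.
  by have [_ en _] := rect_aut_zero aut' r2 r3 nk k0'; rewrite en in n0.
have [-> -> h] := rect_aut_pos aut r1 r2 nk nk' n0 n0'.
split=> // lt; have [a1 [a2 [c1 [c2 [h1 h2 h3]]]]] := h lt.
by exists phi, a1, a2, c1, c2.
Qed.

End RectangularAutomorphisms.

(** * Nilpotent and semisimple elements, and the diagonal case *)

Section Classes.
Variable K : closedFieldType.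
Hypothesis char0 : [pchar K] =i pred0.
Implicit Types (f g h F P Q : S1 K) (m : 'X_{1..2}) (phi : {lrmorphism S1 K -> S1 K}).

Local Notation tdeg := (wdeg 1 1).
Local Notation top := (wlead 1 1).

Lemma nonconstant_bracket f : nonconstant f -> exists g, bracket f g != 0.
Proof.
move=> nc; apply: NNPP => h; apply: nc; exists f@_0%MM; apply: centr_const => // g.
by apply/eqP; apply: contraT => g0; case: h; exists g.
Qed.

Lemma iter_ad_nil_witness f g N : bracket f g != 0 -> iter N (ad f) g = 0 -> nil_witness f.
Proof.
elim: N g => [|N IH] g fg0; first by move=> /= g0; rewrite g0 bracket0r eqxx in fg0.
rewrite iterSr => eN; case: (eqVneq (bracket f (bracket f g)) 0) => [e|ne].
  by exists g.
exact: IH ne eN.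
Qed.

Lemma nilpotent_witness f : nilpotent f -> nil_witness f.
Proof.
case=> [[/nonconstant_bracket [g fg0] hN]|[_ hC _]].
  by have [N [_ eN]] := proj2 (hN g) I; apply: iter_ad_nil_witness fg0 eN.
apply: NNPP => nw; apply: hC => g; split=> [[N [_ eN]]|e]; last by exists 1%N.
apply/eqP; apply: contraT => fg0; case: nw; exact: iter_ad_nil_witness fg0 eN.
Qed.

Lemma ad_sum f (I : Type) (s : seq I) (P : pred I) (e : I -> S1 K) :
  ad f (\sum_(i <- s | P i) e i) = \sum_(i <- s | P i) ad f (e i).
Proof.
apply: (big_morph (ad f)); first by move=> x y; exact: bracketDr.
exact: bracket0r.
Qed.

Lemma eigsum_witness f g : eigsum f g -> bracket f g != 0 -> eig_witness f.
Proof.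
case=> s [e [_ _ he ->]]; rewrite -/(ad f _) ad_sum => n0.
have /hasP [l ls] : has (fun l => l *: e l != 0) s.
  apply: contraNT n0 => /hasPn h; rewrite big1_seq // => l /andP [_ ls].
  by rewrite he //; apply/eqP; have := h l ls; rewrite negbK.
rewrite scaler_eq0 negb_or => /andP [l0 e0]; exists l, (e l); split=> //.
exact: he.
Qed.

Lemma centr_eigsum f g : centr f g -> eigsum f g.
Proof.
move=> fg; case: (eqVneq g 0) => [->|g0].
  by exists [::], (fun _ => 0); rewrite big_nil; split.
exists [:: 0], (fun _ => g); rewrite big_seq1; split=> // l; rewrite inE => /eqP ->.
  by exists g; split=> //; rewrite scale0r; exact: fg.
by rewrite scale0r; exact: fg.
Qed.

Lemma strictly_semisimple_witness f : strictly_semisimple f -> eig_witness f.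
Proof.
case=> /nonconstant_bracket [g fg0] h.
by apply: eigsum_witness fg0; apply/h.
Qed.

Lemma weak_semisimple_witness f : weak_semisimple f -> eig_witness f.
Proof.
case=> _ h _; apply: NNPP => nw; apply: h => g; split; last exact: centr_eigsum.
by move=> eg; apply/eqP; apply: contraT => fg0; case: nw; apply: eigsum_witness eg fg0.
Qed.

Lemma nilpotent_semisimple_tame f : nilpotent f \/ semisimple f -> tame f.
Proof.
case=> [/nilpotent_witness|[/strictly_semisimple_witness|/weak_semisimple_witness]];
  by [left | right].
Qed.

Lemma strictly_semisimple_equiv f g : equivS1 f g -> strictly_semisimple f -> strictly_semisimple g.
Proof.
case=> phi [aut ->] [nc full]; have [psi [_ K1 K2]] := isAut_inv aut; have [_ br] := aut; split.
  by case=> c ec; apply: nc; exists c; rewrite -[f]K1 ec lrmorphC.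
move=> h; split=> // _; have [s [e [us hs he eh]]] := proj2 (full (psi h)) I.
exists s, (fun l => phi (e l)); split=> //.
- move=> l /hs [x [x0 ex]]; exists (phi x); split; first by rewrite isAut_eq0.
  by rewrite /ad -br -/(ad f x) ex lrmorphZ.
- by move=> l /he el; rewrite /ad -br -/(ad f _) el lrmorphZ.
by rewrite -[h]K2 eh (raddf_sum phi).
Qed.

Lemma wdegD_le f g : (tdeg (f + g) <= tdeg f + tdeg g)%N.
Proof.
apply: wdeg_le => m; rewrite mcoeffD; case: (eqVneq f@_m 0) => [->|/(@wdeg_ge _ 1 1) h _].
  by rewrite add0r => /(@wdeg_ge _ 1 1) h; apply: leq_trans h (leq_addl _ _).
exact: leq_trans h (leq_addr _ _).
Qed.

Lemma wdegZ_le (c : K) f : (tdeg (c *: f) <= tdeg f)%N.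
Proof.
apply: wdeg_le => m; rewrite mcoeffZ mulf_eq0 negb_or => /andP [_].
exact: wdeg_ge.
Qed.

(** All iterates stay in the span of the finitely many eigencomponents of g. *)
Lemma eigsum_bounded f g : eigsum f g -> exists B, forall N, (tdeg (iter N (ad f) g) <= B)%N.
Proof.
case=> s [e [_ _ he ->]]; exists (\sum_(l <- s) tdeg (e l))%N => N.
have -> : iter N (ad f) (\sum_(l <- s) e l) = \sum_(l <- s) l ^+ N *: e l.
  elim: N => [|N IH]; first by apply: eq_bigr => l _; rewrite scale1r.
  rewrite iterS IH ad_sum; apply: eq_big_seq => l /he el.
  by rewrite /ad bracketZr -/(ad f _) el scalerA exprSr.
elim: s {he} => [|l s IH]; first by rewrite !big_nil -mpolyC0 wdegC.
rewrite !big_cons (leq_trans (wdegD_le _ _)) // leq_add //; exact: wdegZ_le.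
Qed.

(** If n = 0, then f lies in K[X] and ad_f lowers the Y-degree, which excludes nonzero eigenvalues.
    If n > 0, the growth by k + n - 2 per step in [ad_unbounded] must vanish by [eigsum_bounded]. *)
Lemma strictly_semisimple_rect f k n : strictly_semisimple f -> rectS1 k n f -> (n <= k)%N ->
  (0 < k)%N -> k = 1%N /\ n = 1%N.
Proof.
move=> ss r nk k0; have [fkn _] := r; have tf := rect_top r.
case: n r nk fkn tf => [|n] r nk fkn tf.
  have [l [g [l0 g0 eg]]] := strictly_semisimple_witness ss.
  have wf : wdeg 0 1 f = 0%N.
    apply/eqP; rewrite -leqn0; apply: wdeg_le => m; rewrite /wt mul0n mul1n add0n leqn0.
    by apply: contraR => m1; rewrite (monE m) r.2 //; right; rewrite lt0n.
  have fg0 : bracket f g != 0 by rewrite eg scaler_eq0 negb_or l0.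
  by have := wdeg_bracket_le 0 1 fg0; rewrite eg wdegZ // wf add0n addn1 ltnn.
case: k r nk fkn tf k0 => // k r nk fkn tf _.
have [h hN] := ad_unbounded char0 tf fkn.
have [B hB] := eigsum_bounded (proj2 (proj2 ss h) I).
have := hB B.+1; have [_ ->] := hN B.+1; move: nk; rewrite ltnS.
case: k {r fkn tf hN} => [|k] nk h1; last by move: h1; rewrite mulSn; nia.
by move: nk; rewrite leqn0 => /eqP ->.
Qed.

Lemma bracket_XY_coef g m : (bracket (varX * varY) g)@_m = g@_m *+ m 1%R - g@_m *+ m 0%R.
Proof.
have -> : bracket (varX * varY) g = varY * mderiv 1 g - varX * mderiv 0 g.
  by rewrite bracket_antisym bracketMr bracketXr bracketYr; ring.
by rewrite mcoeffB coef_XdX coef_YdY.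
Qed.

Lemma natmulB_eq0 (x : K) i j : x *+ i - x *+ j = 0 -> x = 0 \/ i = j.
Proof.
rewrite -[x *+ i]mulr_natr -[x *+ j]mulr_natr -mulrBr => /eqP; rewrite mulf_eq0 subr_eq0.
by case/orP=> /eqP; [left | right; apply: natK_inj].
Qed.

(** ad_(XY) is diagonal on monomials, so a second application kills nothing new. *)
Lemma bracket_XY_twice g : bracket (varX * varY) (bracket (varX * varY) g) = 0 ->
  bracket (varX * varY) g = 0.
Proof.
move=> h; apply/mpolyP=> m; rewrite mcoeff0; have := congr1 (mcoeff m) h.
rewrite bracket_XY_coef mcoeff0 => /natmulB_eq0 [//|e].
by rewrite bracket_XY_coef e subrr.
Qed.

Lemma bracket_XYn (c : K) k g : bracket (c *: (varX * varY) ^+ k.+1) g =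
  (c * k.+1%:R) *: ((varX * varY) ^+ k * bracket (varX * varY) g).
Proof.
rewrite bracket_antisym bracketZr bracketXnr /= -scaler_nat scalerA -scalerN.
by congr (_ *: _); rewrite -mulrN -bracket_antisym.
Qed.

(** ad_F is ad_(XY) followed by multiplication by a nonzero multiple of (XY)^k, and the two
    operations commute. *)
Lemma diagonal_no_nil_witness (c : K) k g : c != 0 ->
  let F := c *: (varX * varY) ^+ k.+1 in bracket F (bracket F g) = 0 -> bracket F g = 0.
Proof.
move=> c0; have w0 : (varX * varY) ^+ k != 0 :> S1 K by rewrite expf_neq0 // mulf_neq0 // mpolyX_neq0.
have ck : c * k.+1%:R != 0 :> K by rewrite mulf_neq0 // natK_eq0.
rewrite /= (bracket_XYn c k g) bracketZr bracket_XYn bracketMr bracketXnr bracketff mulr0 mul0rn mul0r add0r.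
move/eqP; rewrite !scaler_eq0 (negPf ck) /= !mulf_eq0 (negPf w0) /= => /eqP /bracket_XY_twice ->.
by rewrite mulr0 scaler0.
Qed.

(** Monomials are grouped by eigenvalue, since different monomials may share one. *)
Lemma monomial_eigsum f (lam : 'X_{1..2} -> K) :
  (forall m, ad f 'X_[m] = lam m *: 'X_[m]) -> eqset (eigsum f) (@fullset K).
Proof.
move=> hl g; split=> // _.
exists (undup [seq lam m | m <- msupp g]), (fun l => \sum_(m <- msupp g | lam m == l) g@_m *: 'X_[m]); split.
- exact: undup_uniq.
- move=> l; rewrite mem_undup => /mapP [m _ ->]; exists 'X_[m]; split=> //.
  exact: mpolyX_neq0.
- move=> l _; rewrite ad_sum scaler_sumr; apply: eq_bigr => m /eqP <-.
  by rewrite /ad bracketZr -/(ad f _) hl !scalerA mulrC.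
rewrite (exchange_big_dep predT) //= {1}(mpolyE g); apply: eq_big_seq => m mg.
have hm : lam m \in undup [seq lam m | m <- msupp g] by rewrite mem_undup map_f.
rewrite -big_filter (eq_filter (a2 := pred1 (lam m))) => [|l]; last by rewrite /= eq_sym.
by rewrite filter_pred1_uniq ?undup_uniq // big_seq1.
Qed.

Lemma strictly_semisimple_XY (c d : K) : c != 0 ->
  strictly_semisimple (c *: (varX * varY) + d%:MP).
Proof.
move=> c0; split.
  case=> u /(congr1 (mcoeff (mon 1 1))).
  have -> : varX * varY = 'X_[mon 1 1] :> S1 K by rewrite monX.
  rewrite mcoeffD mcoeffZ mcoeffX eqxx mulr1 !mcoeffC.
  have -> : (mon 1 1 == 0%MM) = false.
    by apply/eqP=> /(congr1 (fun m : 'X_{1..2} => m (0 : 'I_2))); rewrite /= mon0 mnm0E.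
  by rewrite !mulr0 addr0 => e; rewrite e eqxx in c0.
apply: (@monomial_eigsum _ (fun m => c * ((m 1%R)%:R - (m 0%R)%:R))) => m.
rewrite /ad bracket_antisym bracketDr bracketC addr0 bracketZr -scalerN -bracket_antisym -scalerA.
congr (_ *: _); apply/mpolyP=> m'; rewrite bracket_XY_coef mcoeffZ mcoeffX.
by case: (m =P m') => [<-|_]; rewrite ?mul0rn ?subr0 ?mulr0 // mulr1.
Qed.

Lemma rect11E f : rectS1 1 1 f -> f =
  f@_(mon 1 1) *: (varX * varY) + f@_(mon 1 0) *: varX + f@_(mon 0 1) *: varY + (f@_(mon 0 0))%:MP.
Proof.
case=> _ f0; have -> : varX * varY = 'X_[mon 1 1] :> S1 K by rewrite monX.
have -> : varX = 'X_[mon 1 0] :> S1 K by rewrite /varX U0E.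
have -> : varY = 'X_[mon 0 1] :> S1 K by rewrite /varY U1E.
have -> : (f@_(mon 0 0))%:MP = f@_(mon 0 0) *: 'X_[mon 0 0] :> S1 K.
  have -> : mon 0 0 = 0%MM by apply/mnmP=> l; rewrite mnm0E; case: (ord2P l) => ->; rewrite ?mon0 ?mon1.
  by rewrite mpolyX0 -mul_mpolyC mulr1.
have eqm i j i' j' : (mon i j == mon i' j') = (i == i') && (j == j').
  apply/eqP/andP=> [e|[/eqP -> /eqP ->] //]; split; apply/eqP.
    by have := congr1 (fun m : 'X_{1..2} => m (0 : 'I_2)) e; rewrite /= !mon0.
  by have := congr1 (fun m : 'X_{1..2} => m (1 : 'I_2)) e; rewrite /= !mon1.
apply/mpolyP=> m; rewrite (monE m) !mcoeffD !mcoeffZ !mcoeffX !eqm.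
case: (m 0%R) (m 1%R) => [|[|i]] [|[|j]] /=; rewrite ?mulr0 ?mulr1 ?add0r ?addr0 //;
  by rewrite f0 //; (left + right).
Qed.

(** Completing the product, c XY + al X + be Y = c (X + s)(Y + t) - c s t; shears with exponent 0
    are the translations needed. *)
Lemma strictly_semisimple_rect11 f : rectS1 1 1 f -> strictly_semisimple f.
Proof.
move=> r; have ef := rect11E r; have [c0 _] := r; move: ef c0; rewrite -/(mon 1 1).
move: f@_(mon 1 1) f@_(mon 1 0) f@_(mon 0 1) f@_(mon 0 0) => c al be d -> c0.
pose s := be / c; pose t := al / c.
apply: (strictly_semisimple_equiv _ (@strictly_semisimple_XY c (d - c * s * t) c0)).
exists (shearX s 0 \o shearY t 0 : {lrmorphism S1 K -> S1 K}); split.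
  by apply: isAut_comp; [exact: isAut_shearX | exact: isAut_shearY].
have -> (h : S1 K) : (shearX s 0 \o shearY t 0 : {lrmorphism S1 K -> S1 K}) h =
  shearX s 0 (shearY t 0 h) by [].
rewrite !lrmorphD !lrmorphZ !lrmorphM !lrmorphC !subst_lrX !subst_lrY !lrmorphD !lrmorphZ !lrmorphXn.
rewrite !subst_lrX !subst_lrY !expr0 -!mul_mpolyC !mulr1.
have -> : al = c * t by rewrite mulrCA mulfV // mulr1.
have -> : be = c * s by rewrite mulrCA mulfV // mulr1.
rewrite !mpolyCM mpolyCB !mpolyCM; ring.
Qed.

(** The top form is a multiple of (XY)^(k+1), which has no homogeneous nilpotency witness. So
    [tame_homog] leaves only total degree 2, that is k = 0. *)
Lemma rect_diagonal f k : rectS1 k.+1 k.+1 f ->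
  ~ nil_witness f /\ (eig_witness f -> strictly_semisimple f).
Proof.
move=> r; have [c0 _] := r; have tf : top f = f@_(mon k.+1 k.+1) *: (varX * varY) ^+ k.+1.
  by rewrite (rect_top r) monX exprMn.
have no_wit : ~ exists e R, [/\ whom 1 1 e R, bracket (top f) R != 0 &
    bracket (top f) (bracket (top f) R) = 0].
  case=> e [R [_ n0 e0]]; case/eqP: n0; rewrite tf; apply: diagonal_no_nil_witness => //.
  by rewrite -tf.
split.
  case=> g [fg0 ffg]; apply: no_wit.
  by apply: (@homog_nil_witness _ char0 1 1 isT isT _ _ fg0); apply: wlead_centr.
move=> ew; have [w2|//] := @tame_homog _ char0 1 1 isT isT f (or_intror ew).
have e1 : k = 0%N.
  by move: w2; rewrite (tdeg_monomial_top (rect_top r) c0); lia.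
by apply: strictly_semisimple_rect11; rewrite e1 in r.
Qed.

End Classes.

(** * Assembly of the theorem *)

Theorem proposition2p14 (K : closedFieldType) (char0 : [pchar K] =i pred0)
    (f : {mpoly K[2]}) (hf : nilpotent f \/ semisimple f) :
  (exists! kn : nat * nat, admissible_pair f kn.1 kn.2) /\
  (forall k n : nat, admissible_pair f k n ->
    (strictly_semisimple f -> (k, n) = (1%N, 1%N)) /\
    (nilpotent f \/ weak_semisimple f ->
      (n < k)%N /\
      (forall f1 f2 : {mpoly K[2]},
         equivS1 f f1 -> equivS1 f f2 -> rectS1 k n f1 -> rectS1 k n f2 ->
         exists (phi : {lrmorphism {mpoly K[2]} -> {mpoly K[2]}})
                (a1 a2 c1 c2 : K),
           [/\ isAut phi,
               phi varX = a1 *: varX + c1%:MP,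
               phi varY = a2 *: varY + c2%:MP,
               a1 * a2 = 1 &
               f2 = phi f1]))).
Proof.
have tf : tame f := nilpotent_semisimple_tame char0 hf.
have pos k n : (k, n) <> (0%N, 0%N) -> (n <= k)%N -> (0 < k)%N.
  by case: k => // h; rewrite leqn0 => /eqP n0; case: h; rewrite n0.
split.
  have [g [k [n [eg rg nk k0]]]] := exists_rect char0 tf; exists (k, n); split.
    have [phi [aut eg']] := eg; split=> //; first by case=> k00; rewrite k00 in k0.
    by exists phi; rewrite -eg'.
  case=> k' n' [/= nz nk' [phi [aut rphi]]].
  have [psi [aut' epsi]] := equivS1_trans (equivS1_sym eg) (equivS1_aut f aut).
  rewrite epsi in rphi.
  by have [-> ->] := rect_aut char0 aut' rg rphi nk nk' k0 (pos _ _ nz nk').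
move=> k n [nz nk [phi [aut rphi]]]; have k0 := pos _ _ nz nk.
have eg := equivS1_aut f aut; split=> [ss|hcl].
  have [-> -> //] := strictly_semisimple_rect char0 (strictly_semisimple_equiv eg ss) rphi nk k0.
(* On the diagonal, [rect_diagonal] excludes nilpotency and would make a weak semisimple f strictly
   semisimple, against D(f) != S1. *)
have nk_lt : (n < k)%N.
  rewrite ltn_neqAle nk andbT; apply/eqP=> e; subst n.
  case: k k0 rphi {nz nk} => // k _ rphi; have [no_nil is_ss] := rect_diagonal char0 rphi.
  case: hcl => [/nilpotent_witness/(nil_witness_equiv eg)/no_nil //|ws].
  have [_ _ nfull] := ws; apply: nfull.
  have /is_ss ss := eig_witness_equiv eg (weak_semisimple_witness ws).
  by have [] := strictly_semisimple_equiv (equivS1_sym eg) ss.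
split=> // f1 f2 e1 e2 r1 r2.
have [psi [aut' e12]] := equivS1_trans (equivS1_sym e1) e2; rewrite e12 in r2.
have [_ _ /(_ nk_lt) [chi [a1 [a2 [c1 [c2 [h1 h2 h3 h4 h5]]]]]]] :=
  rect_aut char0 aut' r1 r2 nk nk k0 k0.
by exists chi, a1, a2, c1, c2; split=> //; rewrite e12.
Qed.
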